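(* Let $(X^*,X_*,R,\check R)$ be any reduced irreducible root system. For every dominant coweight $\mu\in X_*$ the inclusion $\mathrm{Adm}(\mu)\supset\mathrm{Perm}^{st}(\mu)$ holds.
   Context: Root data: $(X^*,X_*,R,\check R)$ is a reduced and irreducible root system: $X^*,X_*$ are free abelian groups of finite rank, dual under a perfect pairing $\langle\ ,\ \rangle:X^*\times X_*\to\mathbb Z$, with roots $R\subset X^*$ and coroots $\check R\subset X_*$. Fix a base $\Pi$, with positive roots $R^+$ and highest root $\tilde\alpha$. Let $V=X_*\otimes\mathbb R$. $W_0$ is the finite Weyl group, generated by the reflections $s_\alpha(x)=x-\langle\alpha,x\rangle\check\alpha$. A coweight is an element of $X_*$; $\mu\in X_*$ is dominant if $\langle\alpha,\mu\rangle\ge0$ for all $\alpha\in\Pi$. Affine Weyl groups: for $\alpha\in R$, $k\in\mathbb Z$, let $s_{\alpha,k}(x)=x-(\langle\alpha,x\rangle-k)\check\alpha$, with fixed hyperplane $H_{\alpha,k}$. $W_{\rm aff}$ is the group generated by all $s_{\alpha,k}$; it is a Coxeter group with generators $S_{\rm aff}=\{s_\alpha:\alpha\in\Pi\}\cup\{s_{\tilde\alpha,1}\}$. Alcoves are the connected components of $V-\bigcup_{\alpha\in R,k\in\mathbb Z}H_{\alpha,k}$; the base alcove is $A_0=\{x\in V:\langle\alpha,x\rangle>0\ \forall\alpha\in\Pi,\ \langle\tilde\alpha,x\rangle<1\}$. The extended affine Weyl group $\widetilde W=X_*\rtimes W_0$ ($\lambda\in X_*$ acting as the translation $t_\lambda$)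 acts on alcoves; $\Omega$ is the stabilizer of $A_0$ in $\widetilde W$, and $\widetilde W=W_{\rm aff}\rtimes\Omega$. The Bruhat order extends to $\widetilde W$: for $w,w'\in W_{\rm aff}$, $\tau,\tau'\in\Omega$, $w\tau\le w'\tau'$ iff $w\le w'$ in the Bruhat order of $(W_{\rm aff},S_{\rm aff})$ and $\tau=\tau'$. A vertex of $A_0$ is any point of a facet of minimal dimension of the closure of $A_0$ (a vertex in the usual sense if $R$ spans $X^*\otimes\mathbb R$; in general the condition below does not depend on the choice of the point in the facet). Admissible set: $\mathrm{Adm}(\mu)=\{x\in\widetilde W: x\le t_\lambda\text{ for some }\lambda\in W_0(\mu)\}$. Strongly permissible set: let $B_0\subset V$ be the closed convex cone generated by the $-\check\alpha$, $\alpha\in R^+$. For $v\in V$ and $w\in W_0$, let $B(v,w)$ be the set of all elements $v'=s_r\cdots s_1(v)$ ($r\ge0$), where each $s_i=s_{\alpha_i,k_i}$ with $(\alpha_i,k_i)\in R\times\mathbb Z$, such that for all $i=1,\dots,r$, $s_is_{i-1}\cdots s_1(v)\in s_{i-1}\cdots s_1(v)+w(B_0)$. Let $\tau\in\Omega$ be the unique element with $t_\mu\in W_{\rm aff}\tau$. Then $\mathrm{Perm}^{st}(\mu)$ is the set of $x\in W_{\rm aff}\tau$ such that $x(a)\in B(t_{w\mu}(a),w)$ for every vertex $a$ of $A_0$ and every $w\in W_0$. *)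

(* Defs.v *)
From HB Require Import structures.
From mathcomp Require Import all_boot all_order all_algebra finmap.
From mathcomp Require Import all_classical all_reals all_analysis.

Set Implicit Arguments.
Unset Strict Implicit.
Unset Printing Implicit Defensive.

Import Order.TTheory GRing.Theory Num.Theory.
Import numFieldNormedType.Exports.

Local Open Scope classical_set_scope.
Local Open Scope ring_scope.

(* Dual bases of the two lattices are fixed: X^* = 'rV[int]_n and
   X_* = 'cV[int]_n, the perfect pairing being the matrix product. *)

Definition pairing n (a : 'rV[int]_n) (x : 'cV[int]_n) : int := (a *m x) 0 0.

Record root_datum (n : nat) := RootDatum {
  roots : {fset 'rV[int]_n};
  (* values outside [roots] are irrelevant *)
  coroot : 'rV[int]_n -> 'cV[int]_n;
  coroot_inj : {in roots &, injective coroot};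
  pairing_coroot : forall a, a \in roots -> pairing a (coroot a) = 2;
  refl_roots : forall a b, a \in roots -> b \in roots ->
    b - pairing b (coroot a) *: a \in roots;
  refl_coroots : forall a b, a \in roots -> b \in roots ->
    exists2 c, c \in roots &
      coroot c = coroot b - pairing a (coroot b) *: coroot a
}.

Section RootDatum.
Context {n : nat}.
Implicit Types (D : root_datum n) (Pi : {fset 'rV[int]_n}) (a b : 'rV[int]_n).

(* the only roots proportional to a root a are a and - a *)
Definition reduced D : Prop :=
  forall a b (p q : int), a \in roots D -> b \in roots D -> p != 0 ->
    p *: b = q *: a -> b = a \/ b = - a.

Definition irreducible D : Prop :=
  roots D != fset0 /\
  forall S : {fset 'rV[int]_n}, fsubset S (roots D) ->
    (forall a b, a \in S -> b \in roots D -> b \notin S ->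
       pairing a (coroot D b) = 0 /\ pairing b (coroot D a) = 0) ->
    S = fset0 \/ S = roots D.

Definition nonneg_comb Pi : set 'rV[int]_n :=
  [set a | exists c : 'rV[int]_n -> nat, a = \sum_(b <- Pi) b *+ c b].

Definition is_base D Pi : Prop :=
  [/\ fsubset Pi (roots D),
      forall c : 'rV[int]_n -> int, \sum_(b <- Pi) c b *: b = 0 ->
        forall b, b \in Pi -> c b = 0 &
      forall a, a \in roots D -> nonneg_comb Pi a \/ nonneg_comb Pi (- a)].

Definition positive_roots D Pi : set 'rV[int]_n :=
  [set a | a \in roots D /\ nonneg_comb Pi a].

Definition is_highest_root D Pi (ta : 'rV[int]_n) : Prop :=
  ta \in roots D /\ forall a, a \in roots D -> nonneg_comb Pi (ta - a).

Definition dominant Pi (mu : 'cV[int]_n) : Prop :=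
  forall a, a \in Pi -> 0 <= pairing a mu.

End RootDatum.

(* For a set S of transformations of T. *)
Section Coxeter.
Context {T : Type}.
Implicit Types (S : set (T -> T)) (f g u v w t : T -> T).

Inductive generated S : (T -> T) -> Prop :=
| gen_mem f : S f -> generated S f
| gen_id : generated S id
| gen_comp f g : generated S f -> generated S g -> generated S (f \o g)
| gen_inv f g : generated S f -> cancel f g -> cancel g f -> generated S g.

Fixpoint words S (k : nat) : set (T -> T) :=
  if k is k'.+1 then [set f | exists s g, [/\ S s, words S k' g & f = s \o g]]
  else [set id].

Definition has_length S w (k : nat) : Prop :=
  words S k w /\ forall j, words S j w -> (k <= j)%N.

Definition shorter S u v : Prop :=
  exists k l, [/\ has_length S u k, has_length S v l & (k < l)%N].

(* conjugates of the elements of S in the generated group *)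
Definition reflection S : set (T -> T) :=
  [set t | exists w w' s, [/\ generated S w, cancel w w', cancel w' w, S s
                            & t = w \o s \o w']].

Inductive bruhat S u : (T -> T) -> Prop :=
| bruhat_refl : bruhat S u u
| bruhat_step v t : bruhat S u v -> reflection S t -> shorter S v (v \o t) ->
    bruhat S u (v \o t).

End Coxeter.

Section Apartment.
Context {R : realType} {n : nat}.
Local Notation V := 'cV[R]_n.
Variables (D : root_datum n) (Pi : {fset 'rV[int]_n}) (ta : 'rV[int]_n).
Implicit Types (a : 'rV[int]_n) (k : int) (x v : V) (w f tau : V -> V).

Definition toV (x : 'cV[int]_n) : V := map_mx intr x.

Definition pairingV a x : R := (map_mx intr a *m x) 0 0.

Definition aff_refl a k x : V :=
  x - (pairingV a x - k%:~R) *: toV (coroot D a).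

Definition translation (v x : V) : V := x + v.

Definition W0 : set (V -> V) :=
  generated [set f | exists2 a, a \in roots D & f = aff_refl a 0].

Definition Waff : set (V -> V) :=
  generated [set f | exists a k, a \in roots D /\ f = aff_refl a k].

Definition Saff : set (V -> V) :=
  [set f | (exists2 a, a \in Pi & f = aff_refl a 0) \/ f = aff_refl ta 1].

(* X_* \rtimes W_0, as a group of affine transformations of V *)
Definition Wext : set (V -> V) :=
  [set f | exists lam w, W0 w /\ f = translation (toV lam) \o w].

Definition base_alcove : set V :=
  [set x | (forall a, a \in Pi -> 0 < pairingV a x) /\ pairingV ta x < 1].

Definition Omega : set (V -> V) :=
  [set f | Wext f /\ f @` base_alcove = base_alcove].

Definition bruhat_ext (x y : V -> V) : Prop :=
  exists w w' tau, [/\ Waff w /\ Waff w', Omega tau, x = w \o tau,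
                       y = w' \o tau & bruhat Saff w w'].

Definition Adm (mu : 'cV[int]_n) : set (V -> V) :=
  [set x | Wext x /\
     exists2 w, W0 w & bruhat_ext x (translation (w (toV mu)))].

(* facets of the arrangement of the hyperplanes <a, x> = k *)
Definition facet_of x : set V :=
  [set y | forall a k, a \in roots D ->
     Num.sg (pairingV a y - k%:~R) = Num.sg (pairingV a x - k%:~R)].

Definition is_facet (F : set V) : Prop := exists x, F = facet_of x.

(* U is the direction of the affine hull of F *)
Definition direction (F : set V) (U : {vspace V}) : Prop :=
  (forall x y, F x -> F y -> x - y \in U) /\
  forall U' : {vspace V},
    (forall x y, F x -> F y -> x - y \in U') -> (U <= U')%VS.

Definition vertex (v : V) : Prop :=
  exists F U, [/\ is_facet F /\ F `<=` closure base_alcove, direction F U,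
    forall G U', is_facet G -> G `<=` closure base_alcove -> direction G U' ->
      (\dim U <= \dim U')%N & F v].

Definition convex_cone (C : set V) : Prop :=
  [/\ C 0, forall x y, C x -> C y -> C (x + y) &
      forall (c : R) x, 0 <= c -> C x -> C (c *: x)].

(* the closed convex cone generated by the - coroot a, for a positive *)
Definition B0 : set V :=
  smallest [set C | closed C /\ convex_cone C]
    [set x | exists2 a, positive_roots D Pi a & x = - toV (coroot D a)].

Inductive B (v : V) (w : V -> V) : V -> Prop :=
| B_refl : B v w v
| B_step v' a k : B v w v' -> a \in roots D ->
    (w @` B0) (aff_refl a k v' - v') -> B v w (aff_refl a k v').

(* tau is uniquely determined by mu, as Wext = Waff \rtimes Omega *)
Definition Perm_st (mu : 'cV[int]_n) : set (V -> V) :=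
  [set x | exists tau, [/\ Omega tau,
     exists2 y, Waff y & translation (toV mu) = y \o tau,
     exists2 y, Waff y & x = y \o tau &
     forall v w, vertex v -> W0 w ->
       B (translation (w (toV mu)) v) w (x v)]].

End Apartment.

Arguments W0 R {n} D.
Arguments Adm R {n} D Pi ta mu.
Arguments Perm_st R {n} D Pi ta mu.

(* Main.v *)
From HB Require Import structures.
From mathcomp Require Import all_boot all_order all_algebra finmap.
From mathcomp Require Import all_classical all_reals all_analysis.
From mathcomp Require Import ring lra zify.
Require Import Defs.

(** Let [A_0] be the base alcove and [p] a point of it. A point [b] lying on
    no hyperplane orients all of them: a step [z |-> s z] by an affine
    reflection goes up from [b] when [z] is on the side of [b] of the
    hyperplane of [s]. Chains of upward steps order the points of [V] and,
    testing at [x p], the elements [x] of the extended group ([up]). For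
    [b = p] this is the Bruhat order: by the exchange condition an upward step
    increases the length ([bruhat_up]).

    Let [x] be strongly permissible. Choose [w] in [W_0] such that [x p - p]
    lies in the closed chamber of [w] ([dominant_element]), and let [y] be the
    translation by [w mu]; the aim is [x <= y]. For [d] dominant regular and
    [N] large, the base point [b = p - N w d] is so deep that a reflection
    moving a point by a vector of [w B_0] moves it down as seen from [b]
    ([B_up], by means of an invariant bilinear form). Hence strong
    permissibility for this [w] says that [x a <= y a] from [b] for every
    vertex [a] of [A_0]. Two properties of these orders conclude.

    The vertices decide ([up_of_vertices], a form of Deodhar's lemma). One
    argues by induction on the number of hyperplanes between [b] and [y p]. If
    there are none, each [y a] is minimal, so [x a = y a] for all vertices
    [a], and [x = y]. Otherwise some wall of the alcove of [b], with
    reflection [s], separates [b] from [y p]. Taking in every pair [{z, s z}]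
    the lower member preserves the order, and so does taking the upper one
    ([up_lower_raise]); the first reduces the claim to [s y] in place of [y],
    and the second recovers the claim for [y].

    The base point may be moved from [b] to [p] ([up_move_base]), one wall of
    the current alcove at a time. Each hyperplane crossed on the way has both
    [x p] and [y p] on the side of [p], because [x p - p] and [y p - p = w mu]
    both lie in the closed chamber of [w]; for such elements the two
    orders, before and after the crossing, correspond through
    [up_lower_raise]. *)

Set Implicit Arguments.
Unset Strict Implicit.
Unset Printing Implicit Defensive.

Import Order.TTheory GRing.Theory Num.Theory.
Import numFieldNormedType.Exports.

Local Open Scope classical_set_scope.
Local Open Scope ring_scope.

(** * Pairings and affine roots *)

Section Pairing.
Context {n : nat}.
Implicit Types (a b : 'rV[int]_n) (x y : 'cV[int]_n).

Lemma pairingDl a b x : pairing (a + b) x = pairing a x + pairing b x.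
Proof. by rewrite /pairing mulmxDl mxE. Qed.

Lemma pairingNl a x : pairing (- a) x = - pairing a x.
Proof. by rewrite /pairing mulNmx mxE. Qed.

Lemma pairingZl (c : int) a x : pairing (c *: a) x = c * pairing a x.
Proof. by rewrite /pairing -scalemxAl mxE. Qed.

Lemma pairingBl a b x : pairing (a - b) x = pairing a x - pairing b x.
Proof. by rewrite pairingDl pairingNl. Qed.

Lemma pairingBr a x y : pairing a (x - y) = pairing a x - pairing a y.
Proof. by rewrite /pairing mulmxBr !mxE. Qed.

Lemma pairingZr a (c : int) x : pairing a (c *: x) = c * pairing a x.
Proof. by rewrite /pairing -scalemxAr mxE. Qed.

End Pairing.

Section PairingV.
Context {R : realType} {n : nat}.
Local Notation V := 'cV[R]_n.
Implicit Types (a b : 'rV[int]_n) (x y : V).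

Lemma pairingVD a x y : pairingV a (x + y) = pairingV a x + pairingV a y.
Proof. by rewrite /pairingV mulmxDr mxE. Qed.

Lemma pairingVN a x : pairingV a (- x) = - pairingV a x.
Proof. by rewrite /pairingV mulmxN mxE. Qed.

Lemma pairingVB a x y : pairingV a (x - y) = pairingV a x - pairingV a y.
Proof. by rewrite pairingVD pairingVN. Qed.

Lemma pairingVZ a (c : R) x : pairingV a (c *: x) = c * pairingV a x.
Proof. by rewrite /pairingV -scalemxAr mxE. Qed.

Lemma pairingV0 a : pairingV a (0 : V) = 0.
Proof. by rewrite /pairingV mulmx0 mxE. Qed.

Lemma pairingV_sum (I : Type) (r : seq I) (P : pred I) a (F : I -> V) :
  pairingV a (\sum_(i <- r | P i) F i) = \sum_(i <- r | P i) pairingV a (F i).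
Proof. by rewrite /pairingV mulmx_sumr summxE. Qed.

Lemma pairingVDl a b x : pairingV (a + b) x = pairingV a x + pairingV b x.
Proof. by rewrite /pairingV map_mxD mulmxDl mxE. Qed.

Lemma pairingVNl a x : pairingV (- a) x = - pairingV a x.
Proof. by rewrite /pairingV map_mxN mulNmx mxE. Qed.

Lemma pairingVBl a b x : pairingV (a - b) x = pairingV a x - pairingV b x.
Proof. by rewrite pairingVDl pairingVNl. Qed.

Lemma pairingVZl (c : int) a x : pairingV (c *: a) x = c%:~R * pairingV a x.
Proof. by rewrite /pairingV map_mxZ -scalemxAl mxE. Qed.

Lemma pairingVMnl a (c : nat) x : pairingV (a *+ c) x = pairingV a x *+ c.
Proof.
elim: c => [|c IHc]; last by rewrite !mulrS pairingVDl IHc.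
by rewrite !mulr0n /pairingV map_mx0 mul0mx mxE.
Qed.

Lemma pairingV_suml (I : Type) (r : seq I) (P : pred I) (F : I -> 'rV_n) x :
  pairingV (\sum_(i <- r | P i) F i) x = \sum_(i <- r | P i) pairingV (F i) x.
Proof. by rewrite /pairingV raddf_sum /= mulmx_suml summxE. Qed.

Lemma pairingV_toV a (x : 'cV[int]_n) :
  pairingV a (toV x : V) = (pairing a x)%:~R.
Proof. by rewrite /pairingV /toV -map_mxM mxE. Qed.

Lemma toVB (x y : 'cV[int]_n) : toV (x - y) = toV x - toV y :> V.
Proof. exact: map_mxB. Qed.

Lemma toVZ (c : int) (x : 'cV[int]_n) : toV (c *: x) = c%:~R *: toV x :> V.
Proof. exact: map_mxZ. Qed.

Definition aff_root a (k : int) x : R := pairingV a x - k%:~R.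

Lemma aff_rootN a k x : aff_root (- a) (- k) x = - aff_root a k x.
Proof. rewrite /aff_root pairingVNl intrN; ring. Qed.

Lemma aff_root_inj a b k m : (forall x, aff_root a k x = aff_root b m x) -> a = b /\ k = m.
Proof.
move=> eqab.
have ekm : k = m.
  have := eqab 0; rewrite /aff_root !pairingV0 !sub0r => /oppr_inj.
  by move/eqP; rewrite eqr_int => /eqP.
split=> //; apply/rowP => i; have := eqab (delta_mx i 0).
rewrite /aff_root ekm => /addIr.
by rewrite /pairingV -!colE !mxE => /eqP; rewrite eqr_int => /eqP.
Qed.

End PairingV.

(** A product of two reflections that is unipotent on the roots moves each root
    along an arithmetic progression; staying in a finite set, it is trivial. *)
Lemma fset_progression n (S : {fset 'rV[int]_n}) (g u : 'rV[int]_n) :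
  (forall j : nat, g + u *+ j \in S) -> u = 0.
Proof.
move=> inS; apply/eqP/contraT => u0.
have /existsP[i ui] : [exists i, u 0 i != 0].
  apply: contraNT u0 => /existsPn u0; apply/eqP/rowP => i.
  by rewrite mxE; apply/eqP/negPn/u0.
pose s := [seq g + u *+ j | j <- iota 0 (size (enum_fset S)).+1].
have us : uniq s.
  rewrite map_inj_uniq ?iota_uniq // => j k /addrI /matrixP /(_ 0 i).
  rewrite !mulmxnE; exact: mulrIn.
have sS : {subset s <= enum_fset S} by move=> _ /mapP[j _ ->]; exact: inS.
by have := uniq_leq_size us sS; rewrite size_map size_iota ltnn.
Qed.

(** * Coroots and affine reflections *)

Section CorootReflection.
Context {n : nat} (D : root_datum n).
Implicit Types (a b c e : 'rV[int]_n) (k m : int).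

Definition refl_root b a := a - pairing a (coroot D b) *: b.

Lemma refl_root_in a b : a \in roots D -> b \in roots D ->
  refl_root b a \in roots D.
Proof. by move=> aR bR; exact: refl_roots. Qed.

Lemma root_neq0 a : a \in roots D -> a != 0.
Proof.
move=> aR; apply/eqP => a0; have := pairing_coroot aR.
by rewrite {1}a0 /pairing mul0mx mxE.
Qed.

Lemma opp_root a : a \in roots D -> - a \in roots D.
Proof.
move=> aR; have := refl_root_in aR aR; rewrite /refl_root pairing_coroot //.
suff -> : a - (2 : int) *: a = - a by [].
by apply/rowP => i; rewrite !mxE; ring.
Qed.

(** The axioms only make the right-hand side [d] the coroot of some root [c'].
    Let [e] be the coroot of [c], the reflected root. Both [d] and [e] give
    reflections along [c] that preserve the roots, and the product of the two
    is unipotent, so [d] and [e] pair equally with all roots. But then the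
    reflections of [c] and [c'] have a unipotent product as well, and
    [c = c']. *)
Lemma coroot_refl_root a b : a \in roots D -> b \in roots D ->
  coroot D (refl_root b a) =
  coroot D a - pairing b (coroot D a) *: coroot D b.
Proof.
move=> aR bR; have [c cE] : {c | c = refl_root b a} by exists (refl_root b a).
rewrite -cE; set d := coroot D a - _; pose e := coroot D c.
have cR : c \in roots D by rewrite cE refl_root_in.
have c0 := root_neq0 cR.
have ce : pairing c e = 2 by exact: pairing_coroot.
have cd : pairing c d = 2.
  rewrite cE /d /refl_root !(pairingBl, pairingBr, pairingZl, pairingZr).
  by rewrite !pairing_coroot //; ring.
(* This reflection along [c] with coroot [d] is s_b s_a s_b. *)
have stable_d g : g \in roots D -> g - pairing g d *: c \in roots D.
  move=> gR; suff -> : g - pairing g d *: c =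
      refl_root b (refl_root a (refl_root b g)) by rewrite !refl_root_in.
  apply/rowP => i; rewrite cE /d /refl_root.
  rewrite !(pairingBl, pairingBr, pairingZl, pairingZr) !mxE.
  by rewrite !pairing_coroot //; ring.
(* The product of the reflections along [c] with coroots [e] and [d]
   translates [g] by the multiple [u] of [c]. *)
have eq_de g : g \in roots D -> pairing g d = pairing g e.
  move=> gR; pose u := (pairing g e - pairing g d) *: c.
  have u0 : u = 0.
    apply: (@fset_progression _ (roots D) g) => j.
    elim: j => [|j IHj]; first by rewrite mulr0n addr0.
    have -> : g + u *+ j.+1 =
        refl_root c (g + u *+ j)
          - pairing (refl_root c (g + u *+ j)) d *: c.
      have -> : u *+ j = (j%:R : int) *: u by rewrite scaler_nat.
      rewrite mulrS -[u *+ j]scaler_nat /u /refl_root.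
      rewrite !(pairingNl, pairingDl, pairingZl) -/e ce cd.
      by apply/rowP => i; rewrite !mxE; ring.
    by apply: stable_d; rewrite refl_root_in.
  move/eqP: u0; rewrite /u scalemx_eq0 (negPf c0) orbF subr_eq0.
  by move/eqP->.
have [c' c'R c'd] : exists2 c', c' \in roots D & coroot D c' = d.
  exact: refl_coroots.
suff c'c : c' = c by rewrite -c'd c'c.
(* The product of the reflections of [c] and [c'] translates [c] by
   [2 (c' - c)]. *)
have c'd2 : pairing c' d = 2 by rewrite -c'd pairing_coroot.
have mulE j : (c' - c) *+ 2 *+ j = (2 * j%:R : int) *: (c' - c).
  by rewrite -mulrnA -scaler_nat natrM.
have u0 : (c' - c) *+ 2 = 0.
  apply: (@fset_progression _ (roots D) c) => j.
  elim: j => [|j IHj]; first by rewrite mulr0n addr0.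
  set g := c + _ in IHj.
  have gd : pairing g d = 2.
    by rewrite /g mulE pairingDl pairingZl pairingBl cd c'd2 subrr mulr0 addr0.
  have -> : c + (c' - c) *+ 2 *+ j.+1 = refl_root c' (refl_root c g).
    rewrite /refl_root c'd -/e -eq_de // gd pairingBl pairingZl gd cd.
    by rewrite /g !mulE; apply/rowP => i; rewrite !mxE; ring.
  by rewrite !refl_root_in.
apply/rowP => i; move/rowP/(_ i): u0; rewrite mulmxnE !mxE.
by move/eqP; rewrite mulrn_eq0 /= subr_eq0 => /eqP.
Qed.

Lemma coroot_opp a : a \in roots D -> coroot D (- a) = - coroot D a.
Proof.
move=> aR; have := coroot_refl_root aR aR.
rewrite /refl_root pairing_coroot //.
have opp2 p q (u : 'M[int]_(p, q)) : u - (2 : int) *: u = - u.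
  by apply/matrixP => i j; rewrite !mxE; ring.
by rewrite !opp2.
Qed.

End CorootReflection.

Section AffineReflection.
Context {R : realType} {n : nat} (D : root_datum n).
Local Notation V := 'cV[R]_n.
Local Notation s_ := (@aff_refl R n D).
Implicit Types (a b c : 'rV[int]_n) (k m : int) (x y : V).

Lemma aff_root_refl a k b m x :
  aff_root a k (s_ b m x) =
  aff_root (refl_root D b a) (k - m * pairing a (coroot D b)) x.
Proof.
rewrite /aff_root /aff_refl pairingVB pairingVZ pairingV_toV /refl_root.
by rewrite pairingVBl pairingVZl intrD intrN intrM; ring.
Qed.

Lemma aff_root_refl_self a k x : a \in roots D ->
  aff_root a k (s_ a k x) = - aff_root a k x.
Proof.
move=> aR; rewrite /aff_root /aff_refl pairingVB pairingVZ pairingV_toV.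
by rewrite pairing_coroot //; ring.
Qed.

Lemma aff_reflE a k x : s_ a k x = x - aff_root a k x *: toV (coroot D a).
Proof. by []. Qed.

Lemma aff_refl_fix a k x : aff_root a k x = 0 -> s_ a k x = x.
Proof. by rewrite aff_reflE => ->; rewrite scale0r subr0. Qed.

Lemma aff_reflK a k : a \in roots D -> involutive (s_ a k).
Proof.
move=> aR x; rewrite (aff_reflE a k (s_ a k x)) aff_root_refl_self //.
by rewrite scaleNr opprK aff_reflE subrK.
Qed.

Lemma aff_reflKf (T : Type) a k (f : T -> V) : a \in roots D ->
  s_ a k \o (s_ a k \o f) = f.
Proof. by move=> aR; apply: funext => z /=; rewrite aff_reflK. Qed.

Lemma aff_reflN a k : a \in roots D -> s_ (- a) (- k) = s_ a k.
Proof.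
move=> aR; apply: funext => x; rewrite !aff_reflE aff_rootN coroot_opp //.
by rewrite /toV map_mxN scaleNr scalerN opprK.
Qed.

(** The same [c] and [m] describe the image of the hyperplane and of its
    reflection, so that upward steps and walls can be transported by [g]. *)
Definition normalizes (g : V -> V) := forall a k, a \in roots D ->
  exists c m, [/\ c \in roots D, forall x, aff_root c m (g x) = aff_root a k x
    & forall x, s_ c m (g x) = g (s_ a k x)].

Lemma normalizes_id : normalizes id.
Proof. by move=> a k aR; exists a, k. Qed.

Lemma normalizes_comp f g : normalizes f -> normalizes g -> normalizes (f \o g).
Proof.
move=> nf ng a k aR; have [c [m [cR lc sc]]] := ng a k aR.
have [e [j [eR le se]]] := nf c m cR.
by exists e, j; split=> // x /=; rewrite ?le ?se ?lc ?sc.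
Qed.

Lemma normalizes_refl b m : b \in roots D -> normalizes (s_ b m).
Proof.
move=> bR a k aR.
exists (refl_root D b a), (k - m * pairing a (coroot D b)); split.
- exact: refl_root_in.
- by move=> x; rewrite -aff_root_refl aff_reflK.
move=> x; rewrite aff_reflE -aff_root_refl aff_reflK //.
rewrite coroot_refl_root // toVB toVZ !aff_reflE.
rewrite /aff_root pairingVB pairingVZ pairingV_toV -/(aff_root a k x) -/(aff_root b m x).
by apply/colP => i; rewrite !mxE /aff_root; ring.
Qed.

(** The part of [normalizes] concerned with affine roots, stated for the
    pull-back by [f] so that no inverse of [f] has to be exhibited. *)
Definition preserves_walls (f : V -> V) := forall a k, a \in roots D ->
  exists2 c, c \in roots D & exists m, forall x, aff_root a k (f x) = aff_root c m x.

Lemma preserves_walls_inv g g' : normalizes g' -> cancel g g' ->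
  preserves_walls g.
Proof.
move=> ng gK a k aR; have [c [m [cR lc _]]] := ng a k aR.
by exists c => //; exists m => x; rewrite -lc gK.
Qed.

Lemma preserves_walls_refl b m : b \in roots D -> preserves_walls (s_ b m).
Proof.
move=> bR; apply: preserves_walls_inv (aff_reflK _ bR).
exact: normalizes_refl.
Qed.

Lemma preserves_walls_comp f g :
  preserves_walls f -> preserves_walls g -> preserves_walls (f \o g).
Proof.
move=> pf pg a k aR; have [c cR [m lc]] := pf a k aR.
have [e eR [j le]] := pg c m cR.
by exists e => //; exists j => x; rewrite -le -lc.
Qed.

Lemma preserves_walls_translation (l : 'cV[int]_n) :
  preserves_walls (translation (toV l)).
Proof.
move=> a k aR; exists a => //; exists (k - pairing a l) => x.
by rewrite /aff_root /translation pairingVD pairingV_toV intrD intrN; ring.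
Qed.

End AffineReflection.

(** * Words in a set of involutions *)

Section Words.
Context {T : Type} (S : set (T -> T)).
Hypothesis S_inv : forall s, S s -> involutive s.
Implicit Types f g : T -> T.

Lemma words_generated k f : words S k f -> generated S f.
Proof.
elim: k f => [|k IHk] f /=; first by move=> ->; exact: gen_id.
by case=> s [g [Ss /IHk gg ->]]; apply: gen_comp => //; exact: gen_mem.
Qed.

Lemma words_comp j k f g : words S j f -> words S k g ->
  words S (j + k) (f \o g).
Proof.
elim: j f => [|j IHj] f /=; first by move=> ->.
by case=> s [h [Ss wh ->]] wg; exists s, (h \o g); split=> //; exact: IHj.
Qed.

Lemma words_inv k f : words S k f ->
  exists f', [/\ words S k f', cancel f f' & cancel f' f].
Proof.
elim: k f => [|k IHk] f /=; first by move=> ->; exists id.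
case=> s [g [Ss /IHk[g' [wg' gK Kg]] ->]].
exists (g' \o s); split=> [|x|x].
- have : words S (k + 1) (g' \o s) by apply: words_comp => //; exists s, id.
  by rewrite addn1.
- by rewrite /= S_inv.
- by rewrite /= Kg S_inv.
Qed.

Lemma generated_words f : generated S f -> exists k, words S k f.
Proof.
elim=> {f} [f Sf||f g _ [j wf] _ [k wg]|f g _ [k wf] fK Kf].
- by exists 1%N, f, id.
- by exists 0%N.
- by exists (j + k)%N; exact: words_comp.
have [f' [wf' f'K Kf']] := words_inv wf.
exists k; suff -> : g = f' by [].
by apply: funext => x; rewrite -{2}[x]Kf f'K.
Qed.

Lemma generated_inv f : generated S f ->
  exists f', [/\ generated S f', cancel f f' & cancel f' f].
Proof.
case/generated_words=> k /words_inv[f' [wf' fK Kf]].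
by exists f'; split=> //; exact: words_generated wf'.
Qed.

Lemma generated_ind (P : (T -> T) -> Prop) : P id ->
  (forall s f, S s -> P f -> P (s \o f)) -> forall f, generated S f -> P f.
Proof.
move=> Pid PS f /generated_words[k].
elim: k f => [|k IHk] f /=; first by move=> ->.
by case=> s [g [Ss /IHk Pg ->]]; exact: PS.
Qed.

Lemma has_length_ex f : generated S f -> exists k, has_length S f k.
Proof.
move/generated_words => wf.
have {}wf : exists k, `[< words S k f >] by case: wf => k ?; exists k; apply/asboolP.
case: (ex_minnP wf) => k /asboolP wk kmin; exists k; split=> // j wj.
by apply: kmin; apply/asboolP.
Qed.

End Words.

(** * Separating hyperplanes *)

Section Signs.
Context {R : realType}.
Implicit Types x y z : R.

Lemma same_side_lt0 x y z : 0 < x * y -> x * z < 0 -> y * z < 0.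
Proof.
move=> xy xz; have : (x * y) * (x * z) < 0 by rewrite pmulr_rlt0.
rewrite mulrACA pmulr_rlt0 // -expr2 exprn_even_gt0 //=.
by apply: contraTneq xy => ->; rewrite mul0r ltxx.
Qed.

Lemma same_side_ge0 x y z : 0 < x * y -> 0 <= x * z -> 0 <= y * z.
Proof.
move=> xy; rewrite !leNgt; apply: contra; apply: same_side_lt0.
by rewrite mulrC.
Qed.

Lemma nsep_gt0 x y : x != 0 -> y != 0 -> ~~ (x * y < 0) -> 0 < x * y.
Proof. by move=> x0 y0; rewrite -leNgt lt_neqAle eq_sym mulf_neq0. Qed.

End Signs.

Section Separation.
Context {R : realType} {n : nat} (D : root_datum n).
Local Notation V := 'cV[R]_n.
Local Notation s_ := (@aff_refl R n D).
Implicit Types (a b c : 'rV[int]_n) (k m : int) (p q x y : V).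

Definition sep a k p q : bool := aff_root a k p * aff_root a k q < 0.

Definition generic p := forall a k, a \in roots D -> aff_root a k p != 0.

(** The hyperplane of [(c, m)] is the only one met when crossing it from [p].
    Both signs occur as [(c, m)] and [(- c, - m)] have the same hyperplane. *)
Definition wall p c m := forall a k, a \in roots D ->
  sep a k p (s_ c m p) -> (a, k) = (c, m) \/ (a, k) = (- c, - m).

(** The induction measure for galleries; a covering list takes the place of
    the number of hyperplanes between [p] and [q]. *)
Definition sep_le N p q := exists l : seq ('rV[int]_n * int),
  (size l <= N)%N /\ forall a k, a \in roots D -> sep a k p q -> (a, k) \in l.

Lemma sepC a k p q : sep a k p q = sep a k q p.
Proof. by rewrite /sep mulrC. Qed.

Lemma sepN a k p q : sep (- a) (- k) p q = sep a k p q.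
Proof. by rewrite /sep !aff_rootN mulrNN. Qed.

Lemma generic_preserves f p : preserves_walls D f -> generic p -> generic (f p).
Proof. by move=> pf gp a k aR; have [c cR [m ->]] := pf a k aR; exact: gp. Qed.

Lemma nsep_same_side a k p q : a \in roots D -> generic p -> generic q ->
  ~~ sep a k p q -> 0 < aff_root a k p * aff_root a k q.
Proof. by move=> aR gp gq; apply: nsep_gt0; [exact: gp|exact: gq]. Qed.

(** Crossing the wall removes its own hyperplane from those separating the
    point from [q], and adds none. This is what makes galleries terminate. *)
Lemma sep_wall p q c m a k : generic p -> c \in roots D -> wall p c m ->
  sep c m p q -> a \in roots D -> sep a k (s_ c m p) q ->
  sep a k p q /\ (a, k) != (c, m).
Proof.
move=> gp cR wp spq aR ssq.
have ncm : (a, k) != (c, m).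
  apply: contraTneq spq => -[aE kE]; move: ssq.
  by rewrite aE kE /sep aff_root_refl_self ?mulNr ?oppr_lt0 -?leNgt; [exact: ltW|].
split=> //; apply: contraT => npq.
have q0 : aff_root a k q != 0.
  by apply: contraTneq ssq => q0; rewrite /sep q0 mulr0 ltxx.
have pq := nsep_gt0 (gp _ k aR) q0 npq.
have /(wp _ _ aR)[E|[aE kE]] : sep a k p (s_ c m p).
- rewrite sepC /sep mulrC; apply: (@same_side_lt0 _ (aff_root a k q)).
    by rewrite mulrC.
  by rewrite mulrC.
- by rewrite E eqxx in ncm.
by move: npq; rewrite aE kE sepN spq.
Qed.

Lemma sep_le0 p q : sep_le 0 p q -> forall a k, a \in roots D -> ~~ sep a k p q.
Proof.
case=> l []; rewrite leqn0 size_eq0 => /eqP-> sl a k aR.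
by apply/negP => /(sl _ _ aR).
Qed.

Lemma sep_le_wall N p q c m : generic p -> c \in roots D -> wall p c m ->
  sep c m p q -> sep_le N.+1 p q -> sep_le N (s_ c m p) q.
Proof.
move=> gp cR wp spq [l [sl cl]]; exists (rem (c, m) l); split.
  by rewrite size_rem ?cl //; case: (l) sl.
move=> a k aR /(sep_wall gp cR wp spq aR)[/cl-/(_ aR) al ncm].
have : (a, k) \in (c, m) :: rem (c, m) l.
  by rewrite -(perm_mem (perm_to_rem (cl _ _ cR spq))).
by rewrite inE (negPf ncm).
Qed.

Lemma sep_le_refl N p q c m : c \in roots D -> sep_le N p q ->
  sep_le N (s_ c m p) (s_ c m q).
Proof.
move=> cR [l [sl cl]].
pose act (h : 'rV[int]_n * int) :=
  (refl_root D c h.1, h.2 - m * pairing h.1 (coroot D c)).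
have lact h x : aff_root h.1 h.2 (s_ c m x) = aff_root (act h).1 (act h).2 x.
  exact: aff_root_refl.
have actK : involutive act.
  move=> h; have /aff_root_inj : forall x : V,
      aff_root (act (act h)).1 (act (act h)).2 x = aff_root h.1 h.2 x.
    by move=> x; rewrite -!lact aff_reflK.
  by case: (act _) => ? ?; case: h => ? ? /= [-> ->].
exists (map act l); split; first by rewrite size_map.
move=> a k aR; rewrite /sep !(lact (a, k)) => sh.
rewrite -[(a, k)]actK map_f //.
by have := cl _ _ (refl_root_in aR cR) sh.
Qed.

Lemma sep_le_reflr N p q c m : c \in roots D -> sep_le N (s_ c m p) q ->
  sep_le N p (s_ c m q).
Proof. by move=> cR /(@sep_le_refl _ _ _ c m cR); rewrite aff_reflK. Qed.

Lemma sep_le_ex p q : exists N, sep_le N p q.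
Proof.
pose M := (\sum_(a <- roots D)
  Num.bound (`|pairingV a p| + `|pairingV a q|)%R)%N.
pose ks := map Posz (iota 0 M) ++ map Negz (iota 0 M).
pose l := [seq (a, k) | a <- enum_fset (roots D), k <- ks].
exists (size l), l; split=> // a k aR sa; apply/allpairsP.
exists (a, k); split=> //=.
have kM : (`|k| < M)%N.
  have bM : (Num.bound (`|pairingV a p| + `|pairingV a q|)%R <= M)%N.
    by rewrite /M (big_rem a) //= leq_addr.
  apply: leq_trans bM; rewrite -(ltr_nat R).
  apply: le_lt_trans (archi_boundP _); last by rewrite addr_ge0.
  have -> : `|k|%:R = `|k%:~R : R| by rewrite -intr_norm natr_absz.
  move: sa; rewrite /sep /aff_root; move: (pairingV a p) (pairingV a q) (k%:~R) => x y z.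
  move=> h; have := ler_norm x; have := ler_norm (- x); have := ler_norm y.
  have := ler_norm (- y); rewrite !normrN => h1 h2 h3 h4.
  by rewrite ler_norml; apply/andP; split; rewrite leNgt; apply/negP => zx; move: h;
    apply/negP; rewrite -leNgt; nra.
rewrite mem_cat; case: k kM {sa} => j jM; apply/orP; [left|right]; apply/mapP.
  by exists j => //; rewrite mem_iota.
by exists j => //; rewrite mem_iota /= add0n ltnW.
Qed.

End Separation.

(** * The base alcove and its walls *)

Section BaseAlcove.
Context {R : realType} {n : nat} (D : root_datum n).
Context (Pi : {fset 'rV[int]_n}) (ta : 'rV[int]_n).
Hypothesis (Pibase : is_base D Pi).
Local Notation V := 'cV[R]_n.
Local Notation s_ := (@aff_refl R n D).
Implicit Types (a b c : 'rV[int]_n) (k m : int) (p q x y z : V).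

Lemma simple_root b : b \in Pi -> b \in roots D.
Proof. by have [/fsubsetP + _ _] := Pibase; exact. Qed.

(** Clearing denominators turns independence over the integers into
    independence over the rationals, so the matrix of the simple roots has a
    rational right inverse. *)
Lemma fundamental_coweights : exists om : 'rV[int]_n -> V,
  forall b b', b \in Pi -> b' \in Pi -> pairingV b' (om b) = (b' == b)%:R.
Proof.
have [_ Pifree _] := Pibase.
pose r := enum_fset Pi; pose m := size r.
pose A : 'M[rat]_(m, n) := \matrix_(i, j) ((r`_i : 'rV[int]_n) 0 j)%:~R.
have rfA : row_free A.
  apply: inj_row_free => v vA0.
  pose f (i : 'I_m) : int := numq (v 0 i) * \prod_(j | j != i) denq (v 0 j).
  pose d : int := \prod_j denq (v 0 j).
  have fE i : (f i)%:~R = d%:~R * v 0 i.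
    have -> : d = denq (v 0 i) * \prod_(j | j != i) denq (v 0 j).
      by rewrite /d (bigD1 i).
    rewrite /f !rmorphM /= -{3}[v 0 i]divq_num_den.
    have : (denq (v 0 i))%:~R != 0 :> rat by rewrite intr_eq0 denq_neq0.
    by move=> ?; field.
  pose c (b : 'rV[int]_n) : int :=
    if insub (index b r) is Some i then f i else 0.
  have cE (i : 'I_m) : c r`_i = f i.
    by rewrite /c index_uniq ?fset_uniq // valK.
  have sum0 : \sum_(b <- Pi) c b *: b = 0.
    rewrite (big_nth 0) big_mkord; apply/rowP => j; rewrite summxE mxE.
    apply: (@intr_inj rat); rewrite rmorph_sum rmorph0 /=.
    transitivity (d%:~R * (v *m A) 0 j); last by rewrite vA0 mxE mulr0.
    rewrite mxE mulr_sumr; apply: eq_bigr => i _.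
    by rewrite mxE rmorphM /= (cE i) fE mulrA; congr (_ * _); rewrite mxE.
  apply/rowP => i; have := Pifree c sum0 r`_i (mem_nth _ (ltn_ord i)).
  rewrite cE mxE => fi0; have := fE i; rewrite fi0 => /esym/eqP.
  rewrite mulf_eq0 intr_eq0 prodf_seq_eq0 /=; case/orP => [|/eqP//].
  by case/hasP => j _ /=; rewrite denq_eq0.
have [B AB] := row_freeP rfA.
exists (fun b => \col_j
  if insub (index b r) is Some i then ratr (B j i) else 0) => b b' bP b'P.
have bm : (index b r < m)%N by rewrite index_mem.
have b'm : (index b' r < m)%N by rewrite index_mem.
rewrite /pairingV !mxE.
have := congr1 (fun M : 'M[rat]_m => (ratr (M (Ordinal b'm) (Ordinal bm)) : R)) AB.
rewrite !mxE rmorph_sum /= => E.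
transitivity (\sum_j (ratr (A (Ordinal b'm) j * B j (Ordinal bm)) : R)).
  apply: eq_bigr => j _; rewrite !mxE insubT rmorphM /= ratr_int.
  by rewrite nth_index.
rewrite E -(inj_eq val_inj) /= rmorph_nat; congr (nat_of_bool _)%:R.
by apply/eqP/eqP => [E2|->//]; rewrite -[b'](nth_index 0 b'P) E2 nth_index.
Qed.

Lemma comb_ge0 a x : nonneg_comb Pi a -> (forall b, b \in Pi -> 0 <= pairingV b x) ->
  0 <= pairingV a x.
Proof.
case=> c -> xdom; rewrite pairingV_suml big_seq sumr_ge0 // => b bP.
by rewrite pairingVMnl mulrn_wge0 ?xdom.
Qed.

Lemma comb_eq0 a x b : nonneg_comb Pi a ->
  (forall b, b \in Pi -> 0 <= pairingV b x) -> pairingV a x = 0 ->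
  exists2 c : 'rV[int]_n -> nat, a = \sum_(b <- Pi) b *+ c b &
    forall b, b \in Pi -> 0 < pairingV b x -> c b = 0%N.
Proof.
case=> c -> xdom ax0; exists c => // b' b'P b'x.
move: ax0; rewrite pairingV_suml (big_rem b') //= pairingVMnl => /eqP.
rewrite paddr_eq0 ?mulrn_wge0 ?xdom //; last first.
  rewrite big_seq sumr_ge0 // => b'' /mem_rem b''P.
  by rewrite pairingVMnl mulrn_wge0 ?xdom.
by rewrite mulrn_eq0 (gt_eqF b'x) orbF => /andP[/eqP].
Qed.

(** Reduction to positive roots, for properties that do not see the sign. *)
Lemma root_sign (P : 'rV[int]_n -> Prop) : (forall a, P (- a) -> P a) ->
  (forall a, a \in roots D -> nonneg_comb Pi a -> P a) ->
  forall a, a \in roots D -> P a.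
Proof.
move=> PN Ppos a aR; have [_ _ /(_ _ aR)[aP|aP]] := Pibase; first exact: Ppos.
by apply/PN/Ppos => //; exact: opp_root.
Qed.

Lemma root_height_neq0 a x : (forall b, b \in Pi -> 0 < pairingV b x) ->
  a \in roots D -> pairingV a x != 0.
Proof.
move=> xpos; move: a; refine (root_sign _ _) => a => [|aR aP].
  by rewrite pairingVNl oppr_eq0.
apply/eqP => ax0.
have [|c aE c0] := comb_eq0 0 aP _ ax0; first by move=> b /xpos/ltW.
have := root_neq0 aR; rewrite aE big_seq big1 ?eqxx // => b bP.
by rewrite c0 ?mulr0n ?xpos.
Qed.

Hypothesis (tahigh : is_highest_root D Pi ta).

Lemma highest_root_in : ta \in roots D. Proof. by case: tahigh. Qed.

Lemma le_highest a x : a \in roots D -> (forall b, b \in Pi -> 0 <= pairingV b x) ->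
  pairingV a x <= pairingV ta x.
Proof.
move=> aR xdom; rewrite -subr_ge0 -pairingVBl; apply: comb_ge0 => //.
by case: tahigh => _; apply.
Qed.

Definition closed_alcove x :=
  (forall b, b \in Pi -> 0 <= pairingV b x) /\ pairingV ta x <= 1.

Lemma closed_base_alcove p : base_alcove Pi ta p -> closed_alcove p.
Proof. by case=> pdom pta; split=> [b /pdom|]; exact: ltW. Qed.

Lemma pos_root_bounds a p : base_alcove Pi ta p -> a \in roots D ->
  nonneg_comb Pi a -> 0 < pairingV a p < 1.
Proof.
move=> [pdom pta] aR aP; have pdom' b (bP : b \in Pi) := ltW (pdom b bP).
rewrite lt_neqAle eq_sym root_height_neq0 // comb_ge0 //=.
exact: le_lt_trans (le_highest _ _) pta.
Qed.

Lemma base_alcove_generic p : base_alcove Pi ta p -> generic D p.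
Proof.
move=> pA a k aR; move: a aR k; refine (root_sign _ _) => [a IHa k|a aR aP k].
  by rewrite -oppr_eq0 -aff_rootN.
have /andP[] := pos_root_bounds pA aR aP; rewrite /aff_root subr_eq0 => a0 a1.
apply/eqP => ak; move: a0 a1; rewrite ak ltr0z -[1]/(1%:~R) ltr_int; lia.
Qed.

Lemma closed_alcove_side p x a k : base_alcove Pi ta p -> closed_alcove x ->
  a \in roots D -> 0 <= aff_root a k p * aff_root a k x.
Proof.
move=> pA [xdom xta] aR; move: a aR k; refine (root_sign _ _) => [a IHa k|a aR aP k].
  by rewrite -mulrNN -!aff_rootN.
have /andP[a0 a1] := pos_root_bounds pA aR aP.
have := comb_ge0 aP xdom; have := le_trans (le_highest aR xdom) xta.
rewrite /aff_root; case: (lerP k 0) => k0 x1 x0.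
  have kR : k%:~R <= 0 :> R by rewrite lerz0.
  by apply: mulr_ge0; lra.
have kR : 1 <= k%:~R :> R by rewrite -[1]/(1%:~R) ler_int; lia.
by rewrite -mulrNN; apply: mulr_ge0; lra.
Qed.

Definition simple_wall c m := c \in Pi /\ m = 0 \/ c = ta /\ m = 1.

Lemma simple_wall_root c m : simple_wall c m -> c \in roots D.
Proof. by case=> [[/simple_root]|[->]]; rewrite ?highest_root_in. Qed.

Lemma SaffP f : Saff (R := R) D Pi ta f <->
  exists c m, simple_wall c m /\ f = s_ c m.
Proof.
split=> [[[a aP ->]| ->]|[c [m [[[cP ->]|[-> ->]] ->]]]].
- by exists a, 0; split=> //; left.
- by exists ta, 1; split=> //; right.
- by left; exists c.
- by right.
Qed.

(** The inequalities of the simple roots and of the highest root bound all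
    roots, so a point violating none of them is on the side of [p] of every
    hyperplane. *)
Lemma base_alcove_exit p q a k : base_alcove Pi ta p -> a \in roots D ->
  sep a k p q -> exists c m, simple_wall c m /\ sep c m p q.
Proof.
move=> pA aR spq; have [pdom pta] := pA; apply/not_existsP => nex.
suff qA : closed_alcove q.
  by move: spq; rewrite /sep ltNge closed_alcove_side.
split=> [b bP|].
  rewrite leNgt; apply/negP => bq; apply: (nex b); exists 0.
  split; first by left.
  by rewrite /sep /aff_root !subr0 pmulr_rlt0 // pdom.
rewrite leNgt; apply/negP => taq; apply: (nex ta); exists 1.
split; first by right.
by rewrite /sep /aff_root nmulr_rlt0 ?subr_gt0 ?subr_lt0.
Qed.

Hypothesis (Dred : reduced D).

(** The existence of a point of the wall on no other hyperplane. For a simple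
    root [c] take a small multiple of the sum of the other fundamental
    coweights; for the highest root, the multiple of the sum of all of them
    where its value is 1. A positive root is a nonnegative combination of the
    simple roots and is bounded by the highest root, so its value at this
    point is an integer only in the listed cases; for a simple root, proper
    multiples of [c] are excluded by reducedness. *)
Lemma wall_point c m : simple_wall c m -> exists z,
  [/\ closed_alcove z, aff_root c m z = 0 & forall a k, a \in roots D ->
    aff_root a k z = 0 -> (a, k) = (c, m) \/ (a, k) = (- c, - m)].
Proof.
have [om omP] := fundamental_coweights.
pose del : V := \sum_(b <- Pi) om b.
have del1 b : b \in Pi -> pairingV b del = 1.
  move=> bP; rewrite pairingV_sum (big_rem b) //= omP // eqxx big1_seq ?addr0 //.
  move=> b' /= /[dup] /mem_rem b'P; rewrite mem_rem_uniq ?fset_uniq // !inE.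
  by case/andP=> /negPf nb _; rewrite omP // eq_sym nb.
have del_pos b (bP : b \in Pi) : 0 < pairingV b del by rewrite del1.
pose h := pairingV ta del.
have h0 : 0 < h.
  rewrite lt_neqAle eq_sym root_height_neq0 ?highest_root_in //=.
  have del0 b (bP : b \in Pi) := ltW (del_pos b bP).
  have := le_highest (opp_root highest_root_in) del0.
  by rewrite pairingVNl -/h; lra.
have signed (z : V) : (forall a k, a \in roots D -> nonneg_comb Pi a ->
      aff_root a k z = 0 -> (a, k) = (c, m) \/ (a, k) = (- c, - m)) ->
    forall a k, a \in roots D -> aff_root a k z = 0 ->
      (a, k) = (c, m) \/ (a, k) = (- c, - m).
  move=> zP a k aR; move: a aR k; refine (root_sign _ _) => [a IHa k|a aR aP k].
    move=> lz; have [|[aE kE]|[aE kE]] := IHa (- k).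
    - by rewrite aff_rootN lz oppr0.
    - by right; rewrite -aE -kE !opprK.
    - by left; rewrite -[a]opprK -[k]opprK aE kE !opprK.
  exact: zP.
case=> [[cP m0]|[cE mE]].
  (* All simple roots but [c] are positive at [e *: (del - om c)], and the
     choice of [e] keeps the highest root below 1 there. *)
  subst m; pose e := (h + 1)^-1; have e0 : 0 < e by rewrite invr_gt0; lra.
  have zb b : b \in Pi -> pairingV b (e *: (del - om c)) = e * (1 - (b == c)%:R).
    by move=> bP; rewrite pairingVZ pairingVB del1 // omP.
  have zdom b : b \in Pi -> 0 <= pairingV b (e *: (del - om c)).
    by move=> bP; rewrite zb // mulr_ge0 ?(ltW e0) // subr_ge0 lern1 leq_b1.
  have zta : pairingV ta (e *: (del - om c)) < 1.
    rewrite pairingVZ pairingVB -/h.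
    have : 0 <= pairingV ta (om c).
      have omdom b : b \in Pi -> 0 <= pairingV b (om c).
        by move=> bP; rewrite omP.
      have := le_highest (opp_root highest_root_in) omdom.
      by rewrite pairingVNl; lra.
    rewrite mulrC ltr_pdivrMr; lra.
  exists (e *: (del - om c)); split=> //.
  - by split=> //; exact: ltW.
  - by rewrite /aff_root zb // eqxx subrr mulr0 subr0.
  apply: signed => a k aR aP; rewrite oppr0 /aff_root => lz.
  have k0 : k = 0.
    have := comb_ge0 aP zdom; have := le_lt_trans (le_highest aR zdom) zta.
    move/eqP: lz; rewrite subr_eq0 => /eqP->; rewrite ler0z -[1]/(1%:~R) ltr_int.
    lia.
  rewrite k0 subr0 in lz *.
  have [u aE u0] := comb_eq0 0 aP zdom lz.
  have [] : a = c \/ a = - c; [|by move=> ->; left|by move=> ->; right].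
  apply: (Dred (p := 1) (q := u c)) => //; first exact: simple_root.
  rewrite scale1r aE (big_rem c) //= big1_seq ?addr0.
    by rewrite -[Posz _]natz scaler_nat.
  move=> b /= /[dup] /mem_rem bP; rewrite mem_rem_uniq ?fset_uniq // !inE.
  case/andP=> /negPf nb _; rewrite u0 ?mulr0n // zb // nb subr0 mulr1.
  exact: e0.
have zdom b : b \in Pi -> 0 < pairingV b (h^-1 *: del).
  by move=> bP; rewrite pairingVZ del1 // mulr1 invr_gt0.
have zdom' b (bP : b \in Pi) := ltW (zdom b bP).
have zta : pairingV ta (h^-1 *: del) = 1 by rewrite pairingVZ mulVf ?gt_eqF.
exists (h^-1 *: del); split.
- by split=> //; rewrite zta.
- by rewrite cE mE /aff_root zta subrr.
apply: signed => a k aR aP lz.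
have az : pairingV a (h^-1 *: del) = k%:~R by apply/eqP; rewrite -subr_eq0 -lz.
have k1 : k = 1.
  have := comb_ge0 aP zdom'; have := le_highest aR zdom'.
  have := root_height_neq0 zdom aR; rewrite zta az intr_eq0 ler0z lerz1; lia.
left; rewrite k1 mE; congr (_, _); rewrite cE; apply/esym/eqP.
have dP : nonneg_comb Pi (ta - a) by case: tahigh => _; exact.
have [||u dE u0] := comb_eq0 (x := h^-1 *: del) 0 dP.
- exact: zdom'.
- by rewrite pairingVBl zta az k1 subrr.
rewrite -subr_eq0 dE big_seq big1 // => b bP.
by rewrite u0 ?zdom.
Qed.

(** The point of [wall_point] is fixed by the reflection, in the closure of
    the alcoves of [p] and of its mirror image, and off every other
    hyperplane: it has both alcoves on the same side. *)
Lemma base_wall p c m : base_alcove Pi ta p -> simple_wall c m -> wall D p c m.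
Proof.
move=> pA swc a k aR; have cR := simple_wall_root swc.
have [z [zA cz zP]] := wall_point swc.
have [az|az] := eqVneq (aff_root a k z) 0; first by move=> _; exact: zP.
rewrite /sep ltNge => /negP[]; apply: (@same_side_ge0 _ (aff_root a k z)).
  rewrite lt_neqAle eq_sym mulf_neq0 //=; last exact: base_alcove_generic.
  by rewrite mulrC closed_alcove_side.
rewrite -{1}(aff_refl_fix D cz) !aff_root_refl mulrC closed_alcove_side //.
exact: refl_root_in.
Qed.

End BaseAlcove.

(** * Galleries and the exchange condition *)

Section Galleries.
Context {R : realType} {n : nat} (D : root_datum n).
Context (Pi : {fset 'rV[int]_n}) (ta : 'rV[int]_n).
Hypotheses (Dred : reduced D) (Pibase : is_base D Pi).
Hypothesis (tahigh : is_highest_root D Pi ta).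
Local Notation V := 'cV[R]_n.
Local Notation s_ := (@aff_refl R n D).
Local Notation S := (@Saff R n D Pi ta).
Context (p : V) (pA : base_alcove Pi ta p).
Implicit Types (a b c : 'rV[int]_n) (k m : int) (q x y : V) (f g u v : V -> V).

Let p_generic : generic D p.
Proof. exact: base_alcove_generic Pibase tahigh _ pA. Qed.

Lemma Saff_involutive f : S f -> involutive f.
Proof.
by case/SaffP=> c [m [/(simple_wall_root Pibase tahigh) cR ->]]; exact: aff_reflK.
Qed.

Lemma generated_Saff_normalizes g : generated S g -> normalizes D g.
Proof.
move: g; apply: (generated_ind Saff_involutive); first exact: normalizes_id.
move=> _ f /SaffP[c [m [/(simple_wall_root Pibase tahigh) cR ->]]] nf.
by apply: normalizes_comp => //; exact: normalizes_refl.
Qed.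

Lemma generated_Saff_preserves g : generated S g -> preserves_walls D g.
Proof.
move/(generated_inv Saff_involutive)=> [g' [gg' gK _]].
exact: preserves_walls_inv (generated_Saff_normalizes gg') gK.
Qed.

Lemma generated_Saff_generic g : generated S g -> generic D (g p).
Proof.
by move=> gg; apply: generic_preserves => //; exact: generated_Saff_preserves.
Qed.

Lemma same_side_sep a k x y q : 0 < aff_root a k x * aff_root a k y ->
  sep a k x q = sep a k y q.
Proof.
by move=> xy; apply/idP/idP; apply: same_side_lt0 => //; rewrite mulrC.
Qed.

(** The walls of the alcove of [g p] are the images by [g] of those of the
    base alcove, and the group element reaching the next alcove is again a
    product of generators. *)
Lemma gallery_exit g q a k : generated S g -> a \in roots D ->
  sep a k (g p) q -> exists c m, [/\ c \in roots D, wall D (g p) c m,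
    sep c m (g p) q & generated S (s_ c m \o g)].
Proof.
move=> gg aR; have [g' [gg' gK Kg]] := generated_inv Saff_involutive gg.
have [a' a'R [k' lE]] := generated_Saff_preserves gg k aR.
rewrite /sep -{1}(Kg q) !lE => s'.
have [e [j [sw sej]]] := base_alcove_exit Pibase tahigh pA a'R s'.
have eR := simple_wall_root Pibase tahigh sw.
have [c [m [cR lc sc]]] := generated_Saff_normalizes gg j eR.
exists c, m; split=> //.
- move=> b i bR; have [b' b'R [i' bE]] := generated_Saff_preserves gg i bR.
  rewrite sc /sep !bE => sb.
  have wp := base_wall Pibase tahigh Dred pA sw.
  have lev_eq d h : (forall x, aff_root b i (g x) = aff_root d h (g x)) -> (b, i) = (d, h).
    move=> E; have [|-> -> //] := @aff_root_inj R n b d i h.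
    by move=> x; rewrite -(Kg x).
  have [[b'E i'E]|[b'E i'E]] := wp _ _ b'R sb; [left|right]; apply: lev_eq => x.
    by rewrite bE b'E i'E lc.
  by rewrite bE b'E i'E !aff_rootN lc.
- by rewrite /sep -[q in X in _ * X]Kg !lc.
suff -> : s_ c m \o g = g \o s_ e j.
  by apply: gen_comp => //; apply/gen_mem/SaffP; exists e, j.
by apply: funext => x; exact: sc.
Qed.

(** The group generated by the simple reflections is transitive on alcoves:
    walls separating the current alcove from [q] can be crossed until none
    is left. *)
Lemma gallery_to q : exists2 g, generated S g &
  forall a k, a \in roots D -> ~~ sep a k (g p) q.
Proof.
have [N pq] := sep_le_ex D p q.
suff main g N' : generated S g -> sep_le D N' (g p) q -> exists2 h,
    generated S h & forall a k, a \in roots D -> ~~ sep a k (h p) q.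
  by apply: (main id N) => //; exact: gen_id.
elim: N' g => [|N' IHN] g gg sg.
  by exists g => //; exact: sep_le0 sg.
have [[a [k [aR sa]]]|nsep] := pselect (exists a k, a \in roots D /\ sep a k (g p) q).
  have [c [m [cR wg sc gsg]]] := gallery_exit gg aR sa.
  by apply: IHN gsg _; apply: sep_le_wall sg => //; exact: generated_Saff_generic.
exists g => // a k aR; apply/negP => sa; apply: nsep.
by exists a, k.
Qed.

(** Some image of the base alcove is the alcove of [b], which therefore has
    walls enough to be left in any direction. *)
Lemma wall_between (b q : V) a k : generic D b -> a \in roots D -> sep a k b q ->
  exists c m, [/\ c \in roots D, wall D b c m & sep c m b q].
Proof.
move=> gb aR sa; have [g gg gP] := gallery_to b.
have gb_same c m : c \in roots D -> 0 < aff_root c m (g p) * aff_root c m b.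
  move=> cR; apply: (nsep_same_side cR _ gb (gP _ _ cR)).
  exact: generated_Saff_generic.
rewrite -(same_side_sep _ (gb_same _ _ aR)) in sa.
have [c [m [cR wg sc _]]] := gallery_exit gg aR sa.
exists c, m; split=> //; last by rewrite -(same_side_sep _ (gb_same _ _ cR)).
move=> d i dR; rewrite -(same_side_sep _ (gb_same _ _ dR)) sepC.
rewrite -(@same_side_sep _ _ (s_ c m (g p))); first by rewrite sepC; exact: wg.
by rewrite !aff_root_refl gb_same // refl_root_in.
Qed.

(** The gallery given by a word for [g] crosses the hyperplane of [(a, k)].
    The letter of a crossing step exhibits the reflection as a conjugate of a
    generator, and deleting this letter gives a word for the reflected
    element. *)
Lemma exchange i g a k : words S i g -> a \in roots D -> sep a k p (g p) ->
  reflection S (s_ a k) /\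
  exists2 j, (j < i)%N & words S j (s_ a k \o g).
Proof.
elim: i g a k => [|i IHi] g a k.
  by move=> -> _; rewrite /sep /= -expr2 ltNge sqr_ge0.
case=> s [g1 [Ss wg1 ->]] aR sa.
have /SaffP[c [m [sw sE]]] := Ss; have cR := simple_wall_root Pibase tahigh sw.
(* Either the first step crosses the hyperplane, or the rest of the gallery,
   pulled back by [s], crosses its image. *)
have [eqcm|neqcm] := pselect (s_ a k = s).
  rewrite eqcm; split; first by exists id, id, s; split=> //; exact: gen_id.
  exists i => //; suff -> : s \o (s \o g1) = g1 by [].
  by apply: funext => x /=; rewrite Saff_involutive.
have [a' [k' [a'R la sa']]] := @normalizes_refl R n D c m cR a k aR.
have lev' x : aff_root a k (s x) = aff_root a' k' x by rewrite -la sE aff_reflK.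
have refl' x : s_ a k (s x) = s (s_ a' k' x).
  by rewrite sE -[in RHS](aff_reflK m cR x) sa' aff_reflK.
have np : 0 < aff_root a' k' p * aff_root a' k' (s p).
  apply: (nsep_same_side a'R p_generic).
    by rewrite sE; apply: generic_preserves => //; exact: preserves_walls_refl.
  apply/negP; rewrite sE => /(base_wall Pibase tahigh Dred pA sw a'R) a'E.
  apply: neqcm; apply: funext => x.
  have s'E : s_ a' k' = s.
    by case: a'E => -[-> ->]; rewrite ?aff_reflN // sE.
  rewrite -[x](Saff_involutive Ss) refl' s'E.
  by rewrite !(Saff_involutive Ss).
have s'p : sep a' k' p (g1 p).
  rewrite (same_side_sep _ np) /sep -lev' (Saff_involutive Ss) -lev'.
  exact: sa.
have [[h [h' [t [gh hK Kh St tE]]]] [j ji wj]] := IHi _ _ _ wg1 a'R s'p.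
have srs : s_ a k = s \o s_ a' k' \o s.
  by apply: funext => x /=; rewrite -refl' (Saff_involutive Ss).
split.
  exists (s \o h), (h' \o s), t; split=> //.
  - by apply: gen_comp => //; exact: gen_mem.
  - by move=> x /=; rewrite (Saff_involutive Ss) hK.
  - by move=> x /=; rewrite Kh (Saff_involutive Ss).
  - by rewrite srs tE.
exists j.+1 => //; exists s, (s_ a' k' \o g1); split=> //.
by apply: funext => x /=; rewrite refl'.
Qed.

Lemma sep_self a k q : a \in roots D -> generic D q -> sep a k q (s_ a k q).
Proof.
move=> aR gq; rewrite /sep aff_root_refl_self // mulrN oppr_lt0 -expr2.
by rewrite exprn_even_gt0 //= gq.
Qed.

(** A gallery from [p] to its mirror image crosses the mirror. *)
Lemma aff_refl_reflection a k : a \in roots D -> reflection S (s_ a k).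
Proof.
move=> aR; have [g gg gP] := gallery_to (s_ a k p).
have [i wg] := generated_words Saff_involutive gg.
have sa : sep a k p (g p).
  rewrite sepC (@same_side_sep _ _ _ (s_ a k p)) 1?sepC ?sep_self //.
  apply: (nsep_same_side aR _ _ (gP _ _ aR)); first exact: generated_Saff_generic.
  by apply: generic_preserves => //; exact: preserves_walls_refl.
by case: (exchange wg aR sa).
Qed.

Lemma Waff_generated f : Waff (R := R) D f -> generated S f.
Proof.
elim=> {f} [_ [a [k [aR ->]]]||f g _ gf _ gg|f g _ gf fK Kf].
- have [h [h' [s [gh hK Kh Ss ->]]]] := aff_refl_reflection k aR.
  apply: gen_comp; last exact: gen_inv gh hK Kh.
  by apply: gen_comp => //; exact: gen_mem.
- exact: gen_id.
- exact: gen_comp.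
- exact: gen_inv gf fK Kf.
Qed.

Lemma generated_Waff f : generated S f -> Waff (R := R) D f.
Proof.
elim=> {f} [_ /SaffP[c [m [sw ->]]]||f g _ gf _ gg|f g _ gf fK Kf].
- apply: gen_mem; exists c, m; split=> //.
  exact (simple_wall_root Pibase tahigh sw).
- exact: gen_id.
- exact: gen_comp.
- exact: gen_inv gf fK Kf.
Qed.

(** If the reflection moves [u p] away from [p], its hyperplane separates [p]
    from the image; a shortest word for the image, shortened by [exchange], is
    a word for [u]. *)
Lemma bruhat_up u v a k : generated S u -> a \in roots D ->
  0 <= aff_root a k p * aff_root a k (u p) -> bruhat S v u -> bruhat S v (s_ a k \o u).
Proof.
move=> gu aR up vu; have [u' [gu' uK Ku]] := generated_inv Saff_involutive gu.
have [h [h' [s [gh hK Kh Ss sE]]]] := aff_refl_reflection k aR.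
have -> : s_ a k \o u = u \o (u' \o s_ a k \o u).
  by apply: funext => x /=; rewrite Ku.
apply: bruhat_step => //.
  exists (u' \o h), (h' \o u), s; split=> //.
  - exact: gen_comp.
  - by move=> x /=; rewrite Ku hK.
  - by move=> x /=; rewrite Kh uK.
  - by rewrite sE.
have -> : u \o (u' \o s_ a k \o u) = s_ a k \o u.
  by apply: funext => x /=; rewrite Ku.
have gru : generated S (s_ a k \o u).
  apply: gen_comp => //; rewrite sE; apply: gen_comp; last exact: gen_inv gh hK Kh.
  by apply: gen_comp => //; exact: gen_mem.
have [i ui] := has_length_ex Saff_involutive gu.
have [l ul] := has_length_ex Saff_involutive gru.
exists i, l; split=> //; have [wl _] := ul.
have sa : sep a k p ((s_ a k \o u) p).
  rewrite /sep /= aff_root_refl_self // mulrN oppr_lt0 lt_neqAle up andbT.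
  by rewrite eq_sym mulf_neq0 //; [exact: p_generic|exact: generated_Saff_generic].
have [_ [j jl]] := exchange wl aR sa; rewrite aff_reflKf // => wj.
by apply: leq_ltn_trans jl; case: ui => _; exact.
Qed.

End Galleries.

(** * The orders attached to base points *)

Section Order.
Context {R : realType} {n : nat} (D : root_datum n).
Local Notation V := 'cV[R]_n.
Local Notation s_ := (@aff_refl R n D).
Implicit Types (a c : 'rV[int]_n) (k m : int) (b p q x y : V).

(** With [T = V] and [e = p], the maps are group elements, tested on the alcove
    of [g p]; with [T = unit], they are points. The lowering argument below is
    the same for both. *)
Inductive up {T : Type} (b : V) (e : T) (f : T -> V) : (T -> V) -> Prop :=
| up_refl : up b e f f
| up_step g a k : up b e f g -> a \in roots D ->
    0 <= aff_root a k b * aff_root a k (g e) -> up b e f (s_ a k \o g).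

Section Generalities.
Context {T : Type}.
Implicit Types (e : T) (f g h : T -> V).

Lemma up_one b e f a k : a \in roots D -> 0 <= aff_root a k b * aff_root a k (f e) ->
  up b e f (s_ a k \o f).
Proof. by move=> aR; apply: up_step => //; exact: up_refl. Qed.

Lemma up_trans b e f g h : up b e f g -> up b e g h -> up b e f h.
Proof. by move=> fg; elim=> {h} // h a k _ fh aR; exact: up_step. Qed.

Lemma up_conj b e f g c m : c \in roots D -> up b e f g ->
  up (s_ c m b) e (s_ c m \o f) (s_ c m \o g).
Proof.
move=> cR; elim=> {g} [|g a k _ IH aR ag]; first exact: up_refl.
have [a' [k' [a'R la sa]]] := @normalizes_refl R n D c m cR a k aR.
have -> : s_ c m \o (s_ a k \o g) = s_ a' k' \o (s_ c m \o g).
  by apply: funext => z /=; rewrite sa.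
by apply: up_step => //=; rewrite !la.
Qed.

Lemma up_change_base b b' e f g :
  (forall a k, a \in roots D -> 0 < aff_root a k b * aff_root a k b') ->
  up b e f g -> up b' e f g.
Proof.
move=> bb'; elim=> {g} [|g a k _ IH aR ag]; first exact: up_refl.
by apply: up_step => //; apply: same_side_ge0 ag; exact: bb'.
Qed.

Definition lower b e c m f : T -> V :=
  if 0 <= aff_root c m b * aff_root c m (f e) then f else s_ c m \o f.

(** Let [s] be the reflection in the wall. A step by another reflection [r]
    from [g] conjugates to a step by [s r s] from [s g] to [s r g], which goes
    up because [b] and [s b] are on the same side of the hyperplane of [r]. A
    step by [s] stays within a pair. *)
Lemma up_lower_raise b e f g c m : generic D b -> c \in roots D -> wall D b c m ->
  up b e f g ->
  up b e (lower b e c m f) (lower b e c m g) /\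
  up b e (s_ c m \o lower b e c m f) (s_ c m \o lower b e c m g).
Proof.
move=> gb cR wb; elim=> {g} [|g a k _ [lo hi] aR ag]; first by split; exact: up_refl.
suff [lo' hi'] : up b e (lower b e c m g) (lower b e c m (s_ a k \o g)) /\
    up b e (s_ c m \o lower b e c m g) (s_ c m \o lower b e c m (s_ a k \o g)).
  by split; [exact: up_trans lo'|exact: up_trans hi'].
have up_s h : 0 <= aff_root c m b * aff_root c m (h e) -> up b e h (s_ c m \o h).
  exact: up_one.
have up_s' h : aff_root c m b * aff_root c m (h e) <= 0 -> up b e (s_ c m \o h) h.
  move=> h0; rewrite -{2}[h](aff_reflKf m _ cR); apply: up_one => //=.
  by rewrite aff_root_refl_self // mulrN oppr_ge0.
have [sE|nE] := pselect (s_ a k = s_ c m).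
  (* Only a point, never an alcove, can be on the wall: then [s] fixes [g e]
     and both members of the pair count as lower. *)
  have [c0|c0] := eqVneq (aff_root c m (g e)) 0.
    have g0 : 0 <= aff_root c m b * aff_root c m (g e) by rewrite c0 mulr0.
    have s0 : 0 <= aff_root c m b * aff_root c m (s_ c m (g e)).
      by rewrite aff_root_refl_self // c0 oppr0 mulr0.
    rewrite sE /lower /= g0 s0 aff_reflKf //; split; first exact: up_s.
    by apply: up_s'; rewrite c0 mulr0.
  have bg0 : aff_root c m b * aff_root c m (g e) != 0 by rewrite mulf_neq0 // gb.
  suff -> : lower b e c m (s_ a k \o g) = lower b e c m g.
    by split; exact: up_refl.
  rewrite sE /lower /= aff_root_refl_self // mulrN oppr_ge0 aff_reflKf //.
  by case: ltgtP bg0.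
have [a' [k' [a'R la sa]]] := @normalizes_refl R n D c m cR a k aR.
have refl_s : s_ c m \o (s_ a k \o g) = s_ a' k' \o (s_ c m \o g).
  by apply: funext => z /=; rewrite sa.
have up_sg : up b e (s_ c m \o g) (s_ c m \o (s_ a k \o g)).
  rewrite refl_s; apply: up_one => //=; rewrite la -[b](aff_reflK m cR) la.
  apply: same_side_ge0 ag; apply: (nsep_same_side (D := D)) => //.
    by apply: generic_preserves => //; exact: preserves_walls_refl.
  apply/negP => /(wb _ _ aR) akE; apply: nE.
  by case: akE => -[-> ->]; rewrite ?aff_reflN.
have up_g : up b e g (s_ a k \o g) by exact: up_one.
rewrite /lower; case: ifPn => lg; case: ifPn => lsg; rewrite ?aff_reflKf //.
- split; first exact: up_trans (up_s _ lg) up_sg.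
  by apply: up_trans up_sg (up_s' _ _); rewrite leNgt; apply: contra lsg => /ltW.
- split; last exact: up_trans up_g (up_s _ lsg).
  by apply: up_trans (up_s' _ _) up_g; rewrite leNgt; apply: contra lg => /ltW.
Qed.

End Generalities.
End Order.

Section AlcoveOrder.
Context {R : realType} {n : nat} (D : root_datum n).
Context (Pi : {fset 'rV[int]_n}) (ta : 'rV[int]_n).
Hypotheses (Dred : reduced D) (Pibase : is_base D Pi).
Hypothesis (tahigh : is_highest_root D Pi ta).
Local Notation V := 'cV[R]_n.
Local Notation s_ := (@aff_refl R n D).
Context (p : V) (pA : base_alcove Pi ta p).
Implicit Types (a c : 'rV[int]_n) (k m : int) (b q v : V) (x y : V -> V).

Let p_generic : generic D p.
Proof. exact: base_alcove_generic Pibase tahigh _ pA. Qed.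

Let image_generic x : preserves_walls D x -> generic D (x p).
Proof. by move=> px; exact: generic_preserves. Qed.

Lemma image_side x v a k : preserves_walls D x -> closed_alcove Pi ta v ->
  a \in roots D -> 0 <= aff_root a k (x p) * aff_root a k (x v).
Proof.
move=> px vA aR; have [c cR [m xE]] := px a k aR.
by rewrite !xE; exact: closed_alcove_side Pibase tahigh _ _ _ _ pA vA cR.
Qed.

Definition up_pt b q q' := up D b tt (fun=> q) (fun=> q').

(** A point in the closure of the alcove of [b] is minimal: a step going up
    ends beyond a hyperplane, unless it is trivial. *)
Lemma up_pt_bottom b q q' : generic D b ->
  (forall a k, a \in roots D -> 0 <= aff_root a k b * aff_root a k q') ->
  up_pt b q q' -> q = q'.
Proof.
move=> gb bot qq'.
suff /(_ (fun=> q')) main g : up D b tt (fun=> q) g ->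
    (forall a k, a \in roots D -> 0 <= aff_root a k b * aff_root a k (g tt)) -> q = g tt.
  exact: main.
elim=> {g} // g a k _ IH aR ag gbot.
suff gE : s_ a k \o g = g by rewrite gE in gbot *; exact: IH.
apply: funext => -[] /=; apply: aff_refl_fix; apply/eqP.
have := gbot a k aR; rewrite /= aff_root_refl_self // mulrN oppr_ge0 => ag'.
have /eqP : aff_root a k b * aff_root a k (g tt) = 0 by apply/eqP; rewrite eq_le ag ag'.
by rewrite mulf_eq0 (negPf (gb _ _ aR)).
Qed.

(** A vertex of the closed base alcove is on the same side as its interior, or
    on the wall, where lowering does nothing: choosing the lower member for
    the whole alcove or for each vertex gives the same points. *)
Lemma lower_vertex b c m x v : c \in roots D -> preserves_walls D x ->
  closed_alcove Pi ta v ->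
  lower D b tt c m (fun=> x v) = (fun=> lower D b p c m x v).
Proof.
move=> cR px vA; have xpv := image_side m px vA cR.
rewrite /lower; have [xv0|xv0] := eqVneq (aff_root c m (x v)) 0.
  by case: ifP => _; case: ifP => _; apply: funext => z //=; rewrite aff_refl_fix.
have {}xpv : 0 < aff_root c m (x p) * aff_root c m (x v).
  by rewrite lt_neqAle xpv eq_sym mulf_neq0 // image_generic.
suff -> : (0 <= aff_root c m b * aff_root c m (x v)) =
    (0 <= aff_root c m b * aff_root c m (x p)).
  by case: ifP.
rewrite ![aff_root c m b * _]mulrC; apply/idP/idP; apply: same_side_ge0 => //.
by rewrite mulrC.
Qed.

Context (M : set (V -> V)) (vs : set V).
Hypothesis M_walls : forall x, M x -> preserves_walls D x.
Hypothesis M_refl : forall x a k, a \in roots D -> M x -> M (s_ a k \o x).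
Hypothesis vs_closed : forall v, vs v -> closed_alcove Pi ta v.
Hypothesis vs_rigid : forall x y, M x -> M y ->
  (forall v, vs v -> x v = y v) -> x = y.

(** Deodhar's lemma. If a wall of the alcove of [b] separates [b] from [y p],
    lower both sides with respect to it: the hypothesis passes to the lowered
    elements, vertex by vertex, and the conclusion for them is raised again. *)
Lemma up_of_vertices b x y : generic D b -> M x -> M y ->
  (forall v, vs v -> up_pt b (x v) (y v)) -> up D b p x y.
Proof.
move=> gb; have [N] := sep_le_ex D b (y p).
elim: N x y => [|N IHN] x y sN Mx My xy.
  suff -> : x = y by exact: up_refl.
  apply: vs_rigid => // v vv; apply: up_pt_bottom (xy v vv) => // a k aR.
  have by0 := nsep_same_side aR gb (image_generic (M_walls My)) (sep_le0 sN k aR).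
  rewrite mulrC in by0; apply: (same_side_ge0 by0).
  exact: image_side (M_walls My) (vs_closed vv) aR.
have [[a [k [aR sa]]]|nsep] :=
    pselect (exists a k, a \in roots D /\ sep a k b (y p)); last first.
  apply: IHN => //; exists [::]; split=> // a k aR sa.
  by case: nsep; exists a, k.
have [c [m [cR wb sc]]] := wall_between Dred Pibase tahigh pA gb aR sa.
have sy : sep_le D N b (s_ c m (y p)).
  by apply: sep_le_reflr => //; exact: sep_le_wall sN.
have sc0 : aff_root c m b * aff_root c m (y p) < 0 by [].
have lyE : lower D b p c m y = s_ c m \o y by rewrite /lower leNgt sc0.
have Mlx : M (lower D b p c m x) by rewrite /lower; case: ifP => // _; exact: M_refl.
have xs : up D b p (lower D b p c m x) (s_ c m \o y).
  apply: IHN => // [|v vv]; first exact: M_refl.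
  have := (up_lower_raise gb cR wb (xy v vv)).1.
  rewrite (lower_vertex _ _ cR (M_walls Mx) (vs_closed vv)).
  by rewrite (lower_vertex _ _ cR (M_walls My) (vs_closed vv)) lyE.
have sy0 : 0 <= aff_root c m b * aff_root c m (s_ c m (y p)).
  by rewrite aff_root_refl_self // mulrN oppr_ge0 ltW.
move: xs; rewrite /lower; case: ifPn => [_ xs|nx xs].
  rewrite -(aff_reflKf m y cR); exact: up_step.
have := (up_lower_raise gb cR wb xs).2; rewrite /lower /= sy0.
rewrite aff_root_refl_self // mulrN oppr_ge0 ifT ?aff_reflKf //.
by rewrite leNgt; apply: contra nx => /ltW.
Qed.

(** When the base point crosses a wall with reflection [s], the elements [x]
    and [y], lying beyond the wall, are lowered to [s x] and [s y]; comparing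
    those from [b] is the same as comparing [x] and [y] from [s b]. *)
Lemma up_move_base b x y : generic D b ->
  preserves_walls D x -> preserves_walls D y -> up D b p x y ->
  (forall a k, a \in roots D -> sep a k b p -> ~~ sep a k p (x p)) ->
  (forall a k, a \in roots D -> sep a k b p -> ~~ sep a k p (y p)) ->
  up D p p x y.
Proof.
move=> gb px py; have [N] := sep_le_ex D b p.
elim: N b gb => [|N IHN] b gb sN xy bx by_.
  apply: up_change_base xy => a k aR.
  exact: nsep_same_side gb p_generic (sep_le0 sN k aR).
have [[a [k [aR sa]]]|nsep] :=
    pselect (exists a k, a \in roots D /\ sep a k b p); last first.
  apply: (IHN b) => //; exists [::]; split=> // a k aR sa.
  by case: nsep; exists a, k.
have [c [m [cR wb sc]]] := wall_between Dred Pibase tahigh pA gb aR sa.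
have gsb : generic D (s_ c m b).
  by apply: generic_preserves => //; exact: preserves_walls_refl.
have below z : preserves_walls D z -> ~~ sep c m p (z p) ->
    lower D b p c m z = s_ c m \o z.
  move=> pz npz; rewrite /lower leNgt.
  suff -> : aff_root c m b * aff_root c m (z p) < 0 by [].
  rewrite mulrC; apply: same_side_lt0 (nsep_same_side cR p_generic _ npz) _.
    exact: image_generic.
  by rewrite mulrC.
have sub d i : d \in roots D -> sep d i (s_ c m b) p -> sep d i b p.
  by move=> dR /(sep_wall gb cR wb sc dR)[].
apply: (IHN (s_ c m b)) => //.
- exact: sep_le_wall sN.
- have := up_conj m cR (up_lower_raise gb cR wb xy).1.
  rewrite !below ?aff_reflKf //; [exact: by_|exact: bx].
- by move=> d i dR /sub-/(_ dR); exact: bx.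
- by move=> d i dR /sub-/(_ dR); exact: by_.
Qed.

End AlcoveOrder.

(** * The finite Weyl group and its invariant form *)

Section FiniteWeylGroup.
Context {R : realType} {n : nat} (D : root_datum n).
Local Notation V := 'cV[R]_n.
Local Notation s_ := (@aff_refl R n D).
Implicit Types (a c : 'rV[int]_n) (k m : int) (x y z : V) (w f : V -> V).

Lemma W0_ind (P : (V -> V) -> Prop) : P id ->
  (forall a w, a \in roots D -> P w -> P (s_ a 0 \o w)) ->
  forall w, W0 R D w -> P w.
Proof.
move=> Pid PS; apply: generated_ind => //.
  by move=> _ [a aR ->]; exact: aff_reflK.
by move=> _ w [a aR ->]; exact: PS.
Qed.

Lemma W0_refl a w : a \in roots D -> W0 R D w -> W0 R D (s_ a 0 \o w).
Proof. by move=> aR ww; apply: gen_comp => //; apply: gen_mem; exists a. Qed.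

Lemma Waff_ind (P : (V -> V) -> Prop) : P id ->
  (forall a k f, a \in roots D -> P f -> P (s_ a k \o f)) ->
  forall f, Waff (R := R) D f -> P f.
Proof.
move=> Pid PS; apply: generated_ind => //.
  by move=> _ [a [k [aR ->]]]; exact: aff_reflK.
by move=> _ w [a [k [aR ->]]]; exact: PS.
Qed.

Lemma pairingV_refl0 a c x :
  pairingV a (s_ c 0 x) = pairingV (refl_root D c a) x.
Proof. by have := aff_root_refl D a 0 c 0 x; rewrite /aff_root mul0r !subr0. Qed.

Lemma W0_roots w : W0 R D w -> forall a, a \in roots D ->
  exists2 c, c \in roots D & forall x, pairingV a (w x) = pairingV c x.
Proof.
move: w; apply: W0_ind => [a aR|c w cR IH a aR]; first by exists a.
have [e eR eE] := IH _ (refl_root_in aR cR).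
by exists e => // x; rewrite /= pairingV_refl0.
Qed.

Lemma W0_preserves w : W0 R D w -> preserves_walls D w.
Proof.
move=> ww a k aR; have [c cR cE] := W0_roots ww aR.
by exists c => //; exists k => x; rewrite /aff_root cE.
Qed.

Lemma W0_mx w : W0 R D w -> exists A : 'M[R]_n, forall x, w x = A *m x.
Proof.
move: w; apply: W0_ind => [|a w aR [A wE]].
  by exists 1%:M => x; rewrite mul1mx.
exists (A - toV (coroot D a) *m (map_mx intr a *m A)) => x.
rewrite /= aff_reflE wE mulmxBl /aff_root subr0; congr (_ - _).
rewrite -!mulmxA /pairingV; move: (map_mx _ _ *m _) => c.
by rewrite [c in RHS]mx11_scalar mul_mx_scalar.
Qed.

Lemma W0_lattice w : W0 R D w -> forall l, exists l', w (toV l) = toV l'.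
Proof.
move: w; apply: W0_ind => [l|a w aR IH l]; first by exists l.
have [l' l'E] := IH l.
exists (l' - pairing a l' *: coroot D a).
by rewrite /= l'E aff_reflE /aff_root subr0 pairingV_toV toVB toVZ.
Qed.

Lemma Wext_preserves f : Wext (R := R) D f -> preserves_walls D f.
Proof.
case=> l [w [ww ->]]; apply: preserves_walls_comp (W0_preserves ww).
exact: preserves_walls_translation.
Qed.

Lemma Wext_refl f a k : a \in roots D -> Wext (R := R) D f ->
  Wext (R := R) D (s_ a k \o f).
Proof.
move=> aR [l [w [ww ->]]].
exists (l - (pairing a l - k) *: coroot D a), (s_ a 0 \o w).
split; first exact: W0_refl.
apply: funext => x /=; rewrite /translation !aff_reflE toVB toVZ intrB.
rewrite /aff_root pairingVD pairingV_toV.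
by apply/colP => i; rewrite !mxE; ring.
Qed.

Lemma Wext_Waff_comp f g : Waff (R := R) D f -> Wext (R := R) D g ->
  Wext (R := R) D (f \o g).
Proof.
move=> + wg; move: f; apply: Waff_ind => // a k f aR.
exact: Wext_refl.
Qed.

Lemma Wext_translation w l : W0 R D w ->
  Wext (R := R) D (translation (w (toV l))).
Proof.
move=> ww; have [l' ->] := W0_lattice ww l; exists l', id; split=> //.
exact: gen_id.
Qed.

(** Invariance under the finite Weyl group makes every coroot proportional,
    as a linear form, to its root ([root_form_coroot]). The form may be
    degenerate, since the roots need not span. *)
Definition root_form x y : R := \sum_(a <- roots D) pairingV a x * pairingV a y.

Lemma root_formZr x r y : root_form x (r *: y) = r * root_form x y.
Proof.
rewrite /root_form mulr_sumr; apply: eq_bigr => a _.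
by rewrite pairingVZ; ring.
Qed.

Lemma root_formDr x y z : root_form x (y + z) = root_form x y + root_form x z.
Proof.
rewrite /root_form -big_split; apply: eq_bigr => a _.
by rewrite pairingVD /= mulrDr.
Qed.

Lemma root_formNr x y : root_form x (- y) = - root_form x y.
Proof. by rewrite -scaleN1r root_formZr mulN1r. Qed.

Lemma root_formC x y : root_form x y = root_form y x.
Proof. by apply: eq_bigr => a _; rewrite mulrC. Qed.

Lemma refl_rootK c : c \in roots D -> involutive (refl_root D c).
Proof.
move=> cR a; rewrite /refl_root pairingBl pairingZl pairing_coroot //.
by apply/rowP => i; rewrite !mxE; ring.
Qed.

Lemma root_form_refl c x y : c \in roots D ->
  root_form (s_ c 0 x) (s_ c 0 y) = root_form x y.
Proof.
move=> cR; rewrite /root_form.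
have perm_roots : perm_eq (roots D) (map (refl_root D c) (roots D)).
  apply: uniq_perm; first exact: fset_uniq.
    by rewrite map_inj_uniq ?fset_uniq //; exact: inv_inj (refl_rootK cR).
  move=> a; apply/idP/mapP => [aR|[e eR ->]]; last exact: refl_root_in.
  by exists (refl_root D c a); rewrite ?refl_rootK //; exact: refl_root_in.
rewrite [RHS](perm_big _ perm_roots) big_map /=.
by apply: eq_bigr => a _; rewrite !pairingV_refl0.
Qed.

Lemma root_form_W0 w x y : W0 R D w -> root_form (w x) (w y) = root_form x y.
Proof.
by move: w; apply: W0_ind => // a w aR IH; rewrite /= root_form_refl.
Qed.

(** The reflection of [c] negates its coroot and subtracts from [x] the
    coroot taken [pairingV c x] times; invariance compares the two values. *)
Lemma root_form_coroot c : c \in roots D -> exists2 r : R, 0 < r &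
  forall x, root_form x (toV (coroot D c)) = r * pairingV c x.
Proof.
move=> cR; set cv : V := toV (coroot D c).
have cc : pairingV c cv = 2 by rewrite pairingV_toV pairing_coroot.
exists (root_form cv cv / 2) => [|x].
  rewrite divr_gt0 // /root_form (big_rem c) //= cc ltr_pwDl //.
  by rewrite sumr_ge0 // => a _; rewrite -expr2 sqr_ge0.
have := root_form_refl x cv cR; rewrite !aff_reflE /aff_root !subr0 cc.
have -> : cv - 2 *: cv = - cv by apply/colP => i; rewrite !mxE; ring.
rewrite root_formNr root_formC root_formDr root_formNr root_formZr.
by rewrite -(root_formC x); lra.
Qed.

End FiniteWeylGroup.

Section Chambers.
Context {R : realType} {n : nat} (D : root_datum n).
Context (Pi : {fset 'rV[int]_n}) (ta : 'rV[int]_n).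
Hypotheses (Dred : reduced D) (Pibase : is_base D Pi).
Hypothesis (tahigh : is_highest_root D Pi ta).
Local Notation V := 'cV[R]_n.
Local Notation s_ := (@aff_refl R n D).
Implicit Types (a c : 'rV[int]_n) (k m : int) (x y z v : V) (w f : V -> V).

(** A closed chamber of the finite group meets every orbit. After scaling
    [v], the hyperplanes separating it from [p] all pass through the origin,
    and crossing the walls of the base alcove is done by reflections of the
    finite group. *)
Lemma dominant_element p v : base_alcove Pi ta p ->
  exists2 w, W0 R D w & forall a, a \in roots D ->
    0 <= pairingV a v * pairingV a (w p).
Proof.
move=> pA; have p_generic := base_alcove_generic Pibase tahigh pA.
have small q N : sep_le D N p q ->
    (forall a, a \in roots D -> pairingV a q < 1) ->
    exists2 w, W0 R D w & forall a, a \in roots D ->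
      0 <= pairingV a q * pairingV a (w p).
  elim: N q => [|N IHN] q sN q1.
    exists id => [|a aR]; first exact: gen_id.
    by have := sep_le0 sN 0 aR; rewrite /sep /aff_root !subr0 -leNgt mulrC.
  have [[a [k [aR sa]]]|nsep] :=
      pselect (exists a k, a \in roots D /\ sep a k p q); last first.
    apply: IHN => //; exists [::]; split=> // a k aR sa.
    by case: nsep; exists a, k.
  have [c [m [sw sc]]] := base_alcove_exit Pibase tahigh pA aR sa.
  have cR := simple_wall_root Pibase tahigh sw.
  have wp := base_wall Pibase tahigh Dred pA sw.
  have m0 : m = 0.
    case: sw => [[]//|[cE mE]]; move: sc; rewrite cE mE /sep /aff_root ltNge.
    rewrite -mulrNN mulr_ge0 ?oppr_ge0 ?subr_le0 //.
      by case: pA => _ /ltW.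
    by rewrite ltW // q1 // -cE.
  subst m; have sq : sep_le D N p (s_ c 0 q).
    by apply: sep_le_reflr => //; exact: sep_le_wall sN.
  have [a' a'R|w ww wP] := IHN _ sq.
    by rewrite pairingV_refl0 q1 // refl_root_in.
  exists (s_ c 0 \o w) => [|a' a'R]; first exact: W0_refl.
  rewrite -{1}(aff_reflK 0 cR q) /= !(pairingV_refl0 _ a').
  by apply: wP; exact: refl_root_in.
(* Scaled by [1 / M], the vector has all its root values below 1. *)
pose M := 1 + \sum_(a <- roots D) `|pairingV a v|.
have M0 : 0 < M by rewrite ltr_wpDr // sumr_ge0.
have [N sN] := sep_le_ex D p (M^-1 *: v).
have [a aR|w ww wP] := small _ _ sN.
  rewrite pairingVZ mulrC ltr_pdivrMr // mul1r /M (big_rem a) //=.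
  rewrite (le_lt_trans (ler_norm _)) // ltr_pwDl // lerDl.
  by rewrite sumr_ge0.
exists w => // a /wP; rewrite pairingVZ -mulrA pmulr_rge0 //.
by rewrite invr_gt0.
Qed.

Lemma simple_zero z : (forall b, b \in Pi -> pairingV b z = 0) ->
  forall a, a \in roots D -> pairingV a z = 0.
Proof.
move=> z0; refine (root_sign Pibase _ _) => a.
  by rewrite pairingVNl => /eqP; rewrite oppr_eq0 => /eqP.
move=> _ [c ->]; rewrite pairingV_suml big_seq big1 // => b bP.
by rewrite pairingVMnl z0 // mul0rn.
Qed.

Lemma continuous_bigsum (I : Type) (s : seq I) (F : I -> V -> R) :
  (forall i, continuous (F i)) -> continuous (fun u => \sum_(i <- s) F i u).
Proof.
move=> cF; elim: s => [|i s IHs].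
  have -> : (fun u => \sum_(i <- [::]) F i u) = (fun=> 0).
    by apply: funext => u; rewrite big_nil.
  exact: cst_continuous.
have -> : (fun u => \sum_(j <- i :: s) F j u) =
    (fun u => F i u + \sum_(j <- s) F j u).
  by apply: funext => u; rewrite big_cons.
by move=> z; exact: (cvgD (cF i z) (IHs z)).
Qed.

(** By [root_form_coroot] the generators of the cone lie in this closed
    half-space. *)
Lemma B0_root_form d u : (forall b, b \in Pi -> 0 <= pairingV b d) ->
  B0 (R := R) D Pi u -> root_form D d u <= 0.
Proof.
move=> ddom /(_ [set u | root_form D d u <= 0]); apply.
split=> [|_ [a [aR aP] ->]]; last first.
  have [r r0 rE] := @root_form_coroot R n D a aR.
  rewrite /= root_formNr rE oppr_le0; apply: mulr_ge0; first exact: ltW.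
  exact: comb_ge0 aP ddom.
split; last first.
  split=> [|x y|r x r0] /=.
  - by rewrite -(scale0r 0) root_formZr mul0r.
  - by rewrite root_formDr => *; rewrite ler_wnDl.
  - by rewrite root_formZr => *; rewrite mulr_ge0_le0.
suff cf : continuous (fun u : V => root_form D d u).
  apply: (@preimage_closed _ _ (fun u : V => root_form D d u) [set y | y <= 0]).
    by move=> y _; exact: cf.
  exact: closed_le.
have cM r (f : V -> R) : continuous f -> continuous (fun x => r * f x).
  by move=> cf z; exact: (cvgM (@cst_continuous V R r z) (cf z)).
apply: continuous_bigsum => a; apply: (cM).
have -> : pairingV a = (fun x : V => \sum_i map_mx intr a 0 i * x i 0) :> (V -> R).
  by apply: funext => y; rewrite /pairingV mxE.
by apply: continuous_bigsum => i; apply: cM => y; exact: coord_continuous.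
Qed.

End Chambers.

(** * Deep base points and vertices *)

(** Here [L] and [M] are the values of an affine root at two points, and [t]
    that of its linear part at a direction in which the second point lies
    ahead: going back from the first point by [r] times the direction meets no
    hyperplane that is between the two points. *)
Lemma acute_sign (R : realType) (L M t r : R) : 0 <= r -> 0 <= (M - L) * t ->
  (L - r * t) * L < 0 -> 0 <= L * M.
Proof.
move=> r0 ut; case: (ltrgt0P L) => [L0|L0|->]; last by rewrite mul0r.
  rewrite pmulr_llt0 // pmulr_rge0 // => h.
  have t0 : 0 < t by rewrite ltNge; apply/negP => t0; nra.
  by move: ut; rewrite pmulr_lge0 //; lra.
rewrite nmulr_llt0 // nmulr_rge0 // => h.
have t0 : t < 0 by rewrite ltNge; apply/negP => t0; nra.
by move: ut; rewrite nmulr_lge0 //; lra.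
Qed.

Section Vertices.
Context {R : realType} {n : nat} (D : root_datum n).
Context (Pi : {fset 'rV[int]_n}) (ta : 'rV[int]_n).
Hypotheses (Pibase : is_base D Pi) (tahigh : is_highest_root D Pi ta).
Local Notation V := 'cV[R]_n.
Local Notation s_ := (@aff_refl R n D).
Implicit Types (a b : 'rV[int]_n) (k : int) (p x y z v u d : V) (w f g : V -> V).

(** A nonzero vector [- c] times the coroot of [a] lies in [w B_0] only if [c]
    and the value of [a] at [w d] have the same sign, as the invariant form
    shows. Seen from a base point far away in the direction of [- w d], the
    reverse of the step goes up. *)
Lemma B_up p d w v v' : W0 R D w -> (forall b, b \in Pi -> 0 < pairingV b d) ->
  B D Pi v w v' -> exists N0 : nat, forall N : nat, (N0 <= N)%N ->
    up_pt D (p - N%:R *: w d) v' v.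
Proof.
move=> ww dpos; have ddom b (bP : b \in Pi) := ltW (dpos b bP).
elim=> {v'} [|v' a k _ [N0 IH] aR [u uB0 uE]].
  by exists 0%N => N _; exact: up_refl.
have [c0|c0] := eqVneq (aff_root a k v') 0; first by exists N0; rewrite aff_refl_fix.
pose c := aff_root a k v'; pose t := pairingV a (w d).
have ct : 0 < c * t.
  have [r r0 rE] := @root_form_coroot R n D a aR.
  have [e eR eE] := @W0_roots R n D w ww a aR.
  rewrite lt_neqAle eq_sym mulf_neq0 /=; last 2 first.
  - by [].
  - by rewrite /t eE; exact: root_height_neq0 Pibase _ _ dpos eR.
  have := B0_root_form ddom uB0; rewrite -(root_form_W0 d u ww) uE.
  rewrite aff_reflE addrAC subrr add0r root_formNr root_formZr rE oppr_le0.
  by rewrite -/c -/t mulrCA pmulr_rge0.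
(* For [N >= N1] the base point is beyond the hyperplane of [(a, k)]. *)
pose N1 := Num.bound `|c * aff_root a k p / (c * t)|.
exists (maxn N0 N1) => N; rewrite geq_max => /andP[N0N N1N].
apply: up_trans (IH N N0N).
have -> : (fun=> v') = s_ a k \o (fun=> s_ a k v') :> (unit -> V).
  by apply: funext => z /=; rewrite aff_reflK.
apply: up_one => //; rewrite aff_root_refl_self // -/c.
have -> : aff_root a k (p - N%:R *: w d) = aff_root a k p - N%:R * t.
  by rewrite /aff_root /t pairingVB pairingVZ; ring.
have : c * aff_root a k p / (c * t) <= N%:R.
  apply: le_trans (ler_norm _) _; apply: ltW.
  apply: lt_le_trans (archi_boundP _) _ => //.
  by rewrite ler_nat.
by rewrite ler_pdivrMr // => h; rewrite mulrN mulrBl oppr_ge0; lra.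
Qed.

Lemma closed_alcove_closure p y : base_alcove Pi ta p -> closed_alcove Pi ta y ->
  closure (base_alcove Pi ta) y.
Proof.
move=> [pdom pta] [ydom yta] U Uy.
have ft : (y + t *: (p - y)) @[t --> (0 : R)] --> y.
  rewrite -[X in _ --> X]addr0; apply: cvgD; first exact: cvg_cst.
  by rewrite -[X in _ --> X](scale0r (p - y)); apply: cvgZr_tmp; exact: cvg_id.
have {}ft := cvg_at_right_filter ft.
have : \forall t \near 0^'+, U (y + t *: (p - y)) /\ 0 < t < 1.
  near=> t; split; first by near: t; exact: ft.
  by apply/andP; split; near: t; [exact: nbhs_right_gt|exact: nbhs_right_lt].
case/filter_ex => t [Ut /andP[t0 t1]]; exists (y + t *: (p - y)); split=> //.
split=> [b bP|]; rewrite pairingVD pairingVZ pairingVB.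
  by have := ydom b bP; have := pdom b bP; nra.
by nra.
Unshelve. all: by end_near. Qed.

(** This kernel is the direction of the facets of minimal dimension. *)
Lemma exists_root_kernel : exists K : {vspace V}, forall z,
  z \in K <-> forall a, a \in roots D -> pairingV a z = 0.
Proof.
pose r := enum_fset (roots D).
pose A : 'M[R]_(size r, n) := \matrix_(i, j) ((r`_i : 'rV[int]_n) 0 j)%:~R.
exists (lker (linfun (mulmx A))) => z; rewrite memv_ker lfunE /=.
have Az i : (A *m z) i 0 = pairingV r`_i z.
  by rewrite /pairingV !mxE; apply: eq_bigr => j _; rewrite !mxE.
split=> [/eqP A0 a aR|z0]; last first.
  by apply/eqP/colP => i; rewrite Az mxE; apply: z0; rewrite mem_nth.
have ir : (index a r < size r)%N by rewrite index_mem.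
by have := Az (Ordinal ir); rewrite A0 mxE /= nth_index.
Qed.

Lemma closed_facet v y : closed_alcove Pi ta v -> facet_of D v y ->
  closed_alcove Pi ta y.
Proof.
move=> [vdom vta] vy; split=> [b bP|].
  have := vy b 0 (simple_root Pibase bP); rewrite !subr0 => E.
  by rewrite -sgr_ge0 E sgr_ge0 vdom.
have := vy ta 1 (highest_root_in tahigh) => E.
by rewrite -subr_le0 -sgr_le0 E sgr_le0 subr_le0.
Qed.

(** Every facet is stable under translation by the common kernel of the roots,
    so its direction contains this kernel; a facet with no other directions
    has minimal dimension. *)
Lemma facet_vertex p v : base_alcove Pi ta p -> closed_alcove Pi ta v ->
  (forall y, facet_of D v y -> forall a, a \in roots D -> pairingV a (y - v) = 0) ->
  vertex D Pi ta v.
Proof.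
move=> pA vA vmin; have [K KE] := exists_root_kernel.
have K_facet x z : z \in K -> facet_of D x (x + z).
  by move=> /KE z0 a k aR; rewrite pairingVD z0 // addr0.
have K_sub x (U : {vspace V}) :
    (forall y z, facet_of D x y -> facet_of D x z -> y - z \in U) -> (K <= U)%VS.
  move=> dU; apply/subvP => z zK.
  by have := dU (x + z) x (K_facet _ _ zK); rewrite addrC addKr; apply.
exists (facet_of D v), K; split=> //.
- split; first by exists v.
  by move=> y vy; exact: closed_alcove_closure pA (closed_facet vA vy).
- split=> [x y vx vy|U']; last exact: K_sub.
  apply/KE => a aR.
  have -> : x - y = (x - v) - (y - v) by rewrite opprB addrA subrK.
  by rewrite pairingVB !vmin // subrr.
- by move=> _ U' [x ->] _ [/K_sub/dimvS].
Qed.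

Context (om : 'rV[int]_n -> V).
Hypothesis omP : forall b b', b \in Pi -> b' \in Pi ->
  pairingV b' (om b) = (b' == b)%:R.

Let om_ge0 b b' : b \in Pi -> b' \in Pi -> 0 <= pairingV b' (om b).
Proof. by move=> bP b'P; rewrite omP. Qed.

Let ta_om b : b \in Pi -> 0 < pairingV ta (om b).
Proof.
move=> bP; have := le_highest tahigh (simple_root Pibase bP) (fun b' => @om_ge0 b b' bP).
by rewrite omP // eqxx; apply: lt_le_trans.
Qed.

Lemma coweight_sum b (F : 'rV[int]_n -> R) : b \in Pi ->
  \sum_(b' <- Pi) F b' * pairingV b (om b') = F b.
Proof.
move=> bP; rewrite (big_rem b) //= omP // eqxx mulr1 big1_seq ?addr0 //.
move=> b' /= /[dup] /mem_rem b'P; rewrite mem_rem_uniq ?fset_uniq // !inE.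
by case/andP=> /negPf nb _; rewrite omP // eq_sym nb mulr0.
Qed.

Lemma coweight_decomposition z : exists2 z0,
  forall a, a \in roots D -> pairingV a z0 = 0 &
  z = z0 + \sum_(b <- Pi) pairingV b z *: om b.
Proof.
exists (z - \sum_(b <- Pi) pairingV b z *: om b); last by rewrite subrK.
apply: (simple_zero Pibase) => b bP; rewrite pairingVB pairingV_sum.
under eq_bigr do rewrite pairingVZ.
by rewrite coweight_sum // subrr.
Qed.

(** The vertex of the base alcove opposite to the wall of the simple root [b]. *)
Definition alcove_vertex b : V := (pairingV ta (om b))^-1 *: om b.

Lemma alcove_vertex_closed b : b \in Pi -> closed_alcove Pi ta (alcove_vertex b).
Proof.
move=> bP; split=> [b' b'P|]; rewrite pairingVZ.
  by rewrite mulr_ge0 ?om_ge0 // invr_ge0 ltW // ta_om.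
by rewrite mulVf // gt_eqF // ta_om.
Qed.

Lemma origin_closed : closed_alcove Pi ta (0 : V).
Proof. by split=> [b _|]; rewrite pairingV0. Qed.

Lemma origin_vertex p : base_alcove Pi ta p -> vertex D Pi ta (0 : V).
Proof.
move=> pA; apply: facet_vertex pA origin_closed _ => y y0 a aR.
have := y0 a 0 aR; rewrite pairingV0 !subr0 sgr0 => /eqP.
by rewrite sgr_eq0 => /eqP.
Qed.

Lemma alcove_vertex_vertex p b : base_alcove Pi ta p -> b \in Pi ->
  vertex D Pi ta (alcove_vertex b).
Proof.
move=> pA bP; apply: facet_vertex pA (alcove_vertex_closed bP) _ => y vy.
have taR := highest_root_in tahigh; have tb := ta_om bP.
have yv a k : a \in roots D -> pairingV a (alcove_vertex b) = k%:~R ->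
    pairingV a (y - alcove_vertex b) = 0.
  move=> aR ak; have := vy a k aR; rewrite pairingVB ak subrr sgr0 => /eqP.
  by rewrite sgr_eq0 => /eqP.
have other b' : b' \in Pi -> b' != b -> pairingV b' (y - alcove_vertex b) = 0.
  move=> b'P nb; apply: (yv _ 0); first exact (simple_root Pibase b'P).
  by rewrite pairingVZ (omP bP b'P) (negPf nb) mulr0.
have ta0 : pairingV ta (y - alcove_vertex b) = 0.
  by apply: (yv _ 1) => //; rewrite pairingVZ mulVf // gt_eqF.
apply: (simple_zero Pibase) => b' b'P; have [->|] := eqVneq b' b; last exact: other.
have [z0 z0P zE] := coweight_decomposition (y - alcove_vertex b).
move: ta0; rewrite {1}zE pairingVD z0P // add0r pairingV_sum (big_rem b) //=.
rewrite big1_seq ?addr0 ?pairingVZ => [/eqP|b'' /= /[dup] /mem_rem b''P].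
  by rewrite mulf_eq0 (gt_eqF tb) orbF => /eqP.
rewrite mem_rem_uniq ?fset_uniq // !inE => /andP[nb _].
by rewrite pairingVZ other // mul0r.
Qed.

Lemma W0_fix w z : W0 R D w -> (forall a, a \in roots D -> pairingV a z = 0) ->
  w z = z.
Proof.
move=> + z0; move: w; apply: W0_ind => // a w aR /= ->.
by rewrite aff_reflE /aff_root z0 // subrr scale0r subr0.
Qed.

(** The points [0] and [alcove_vertex b], together with the common kernel of
    the roots, which the finite Weyl group fixes, span [V] affinely. *)
Lemma Wext_eq_vertices f g : Wext (R := R) D f -> Wext (R := R) D g ->
  f 0 = g 0 -> (forall b, b \in Pi -> f (alcove_vertex b) = g (alcove_vertex b)) ->
  f = g.
Proof.
case=> l [w [ww ->]] [l' [w' [ww' ->]]]; rewrite /translation /=.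
have [A wE] := W0_mx ww; have [A' w'E] := W0_mx ww'.
rewrite !wE !w'E !mulmx0 !add0r => ll' vE; rewrite ll' in vE *.
have omE b : b \in Pi -> A *m om b = A' *m om b.
  move=> bP; have := vE b bP; rewrite wE w'E => /addIr.
  rewrite /alcove_vertex -!scalemxAr => /scalerI; apply.
  by rewrite invr_eq0 gt_eqF // ta_om.
apply: funext => z /=; congr (_ + _).
have [z0 z0P ->] := coweight_decomposition z.
have := W0_fix ww' z0P; rewrite -{2}(W0_fix ww z0P) wE w'E => z0E.
rewrite wE w'E !mulmxDr z0E !mulmx_sumr; congr (_ + _).
rewrite !big_seq; apply: eq_bigr => b bP.
by rewrite -!scalemxAr omE.
Qed.

Lemma sum_coweights b : b \in Pi -> pairingV b (\sum_(b' <- Pi) om b') = 1.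
Proof.
move=> bP; rewrite pairingV_sum -(coweight_sum (fun=> 1) bP).
by apply: eq_bigr => b' _; rewrite mul1r.
Qed.

End Vertices.

(** * The inclusion *)

Section Final.
Context {R : realType} {n : nat} (D : root_datum n).
Context (Pi : {fset 'rV[int]_n}) (ta : 'rV[int]_n).
Hypotheses (Dred : reduced D) (Pibase : is_base D Pi).
Hypothesis (tahigh : is_highest_root D Pi ta).
Local Notation V := 'cV[R]_n.
Local Notation s_ := (@aff_refl R n D).
Implicit Types (a b : 'rV[int]_n) (k : int) (p x y z v d : V) (w f g : V -> V).

(** As [d] has integral values on the roots, moving a point by integral
    multiples of the images of [d] under the finite Weyl group keeps it off
    the hyperplanes. *)
Lemma integral_height d a : (forall b, b \in Pi -> pairingV b d = 1) ->
  a \in roots D -> exists j : int, pairingV a d = j%:~R.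
Proof.
move=> d1; move: a; refine (root_sign Pibase _ _) => a.
  by case=> j; rewrite pairingVNl => E; exists (- j); rewrite intrN -E opprK.
move=> _ [c ->]; exists (\sum_(b <- Pi) (c b)%:Z).
rewrite pairingV_suml rmorph_sum /= !big_seq; apply: eq_bigr => b bP.
by rewrite pairingVMnl d1.
Qed.

Lemma base_alcove_scale d : (forall b, b \in Pi -> pairingV b d = 1) ->
  exists2 r : R, 0 < r & base_alcove Pi ta (r *: d).
Proof.
move=> d1; have h0 : 0 <= pairingV ta d.
  have d0 b : b \in Pi -> 0 <= pairingV b d by move=> bP; rewrite d1.
  have := le_highest tahigh (opp_root (highest_root_in tahigh)) d0.
  by rewrite pairingVNl; lra.
exists (pairingV ta d + 1)^-1; first by rewrite invr_gt0; lra.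
split=> [b bP|]; first by rewrite pairingVZ (d1 b bP) mulr1 invr_gt0; lra.
by rewrite pairingVZ mulrC ltr_pdivrMr; lra.
Qed.

Lemma dominant_pairing mu d a : dominant Pi mu ->
  (forall b, b \in Pi -> 0 <= pairingV b d) -> a \in roots D ->
  0 <= pairingV a (toV mu : V) * pairingV a d.
Proof.
move=> mud ddom; move: a; refine (root_sign Pibase _ _) => a.
  by rewrite !pairingVNl mulrNN.
move=> _ aP; apply: mulr_ge0; last exact: comb_ge0 aP ddom.
by apply: comb_ge0 aP _ => b bP; rewrite pairingV_toV ler0z; exact: mud.
Qed.

(** Both [p] and [tau p] are in the base alcove, hence steps tested at the image
    of either are the same; no step changes the factor [tau]. *)
Lemma up_bruhat p tau u f : base_alcove Pi ta p -> base_alcove Pi ta (tau p) ->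
  generated (Saff D Pi ta) u -> up D p p (u \o tau) f ->
  exists u', [/\ generated (Saff D Pi ta) u', f = u' \o tau &
    bruhat (Saff D Pi ta) u u'].
Proof.
move=> pA tA gu; elim=> {f} [|f a k _ [u' [gu' -> uu']] aR af].
  by exists u; split=> //; exact: bruhat_refl.
have bu : bruhat (Saff D Pi ta) u (s_ a k \o u').
  apply: (bruhat_up Dred Pibase tahigh pA gu' aR) => //.
  have [c cR [m lE]] := generated_Saff_preserves Pibase tahigh gu' k aR.
  move: af; rewrite /= !lE => af.
  have tc : 0 < aff_root c m (tau p) * aff_root c m p.
    rewrite lt_neqAle (closed_alcove_side Pibase tahigh _ tA) //; last first.
      exact: closed_base_alcove.
    by rewrite andbT eq_sym mulf_neq0 // (base_alcove_generic Pibase tahigh _).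
  by rewrite mulrC; apply: (same_side_ge0 tc); rewrite mulrC.
exists (s_ a k \o u'); split=> //.
apply: gen_comp => //; apply: (Waff_generated Dred Pibase tahigh pA).
by apply: gen_mem; exists a, k.
Qed.

Lemma eventually_seq (s : seq 'rV[int]_n) (P : 'rV[int]_n -> nat -> Prop) :
  (forall b, b \in s -> exists N0, forall N, (N0 <= N)%N -> P b N) ->
  exists N0, forall b N, b \in s -> (N0 <= N)%N -> P b N.
Proof.
elim: s => [|c s IHs] ev; first by exists 0%N.
have [N1 N1P] := ev c (mem_head c s).
have [|N2 N2P] := IHs; first by move=> b bs; apply: ev; rewrite inE bs orbT.
exists (maxn N1 N2) => b N; rewrite inE geq_max => /orP[/eqP->|bs] /andP[h1 h2].
  exact: N1P.
exact: N2P.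
Qed.

End Final.

Theorem proposition2 (R : realType) (n : nat) (D : root_datum n)
    (Pi : {fset 'rV[int]_n}) (ta : 'rV[int]_n) (mu : 'cV[int]_n)
    (Dred : reduced D) (Dirr : irreducible D)
    (Pibase : is_base D Pi) (tahigh : is_highest_root D Pi ta)
    (mudom : dominant Pi mu) :
  (Perm_st R D Pi ta mu `<=` Adm R D Pi ta mu)%classic.
Proof.
move=> x [tau [[tauW tauA] _ [u uW xE] xB]].
have [om omP] := @fundamental_coweights R n D Pi Pibase.
pose d := \sum_(b <- Pi) om b.
have d1 b (bP : b \in Pi) : pairingV b d = 1 := sum_coweights omP bP.
have dpos b : b \in Pi -> 0 < pairingV b d by move=> bP; rewrite d1.
have ddom b (bP : b \in Pi) := ltW (dpos b bP).
have [r r0 pA] := base_alcove_scale tahigh d1; set p := r *: d in pA.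
have p_generic := base_alcove_generic Pibase tahigh pA.
have xW : Wext D x by rewrite xE; exact: Wext_Waff_comp.
have [w wW wP] := dominant_element Dred Pibase tahigh (x p - p) pA.
have wpE a : pairingV a (w p) = r * pairingV a (w d).
  by have [A wE] := W0_mx wW; rewrite !wE /p -scalemxAr pairingVZ.
pose y := translation (w (toV mu)).
have yW : Wext D y := Wext_translation mu wW.
(* The base points tending to infinity in the direction opposite to the
   chamber of [w]. *)
pose base N := p - N%:R *: w d.
have base_lev a k N : aff_root a k (base N) = aff_root a k p - N%:R * pairingV a (w d).
  by rewrite /aff_root /base pairingVB pairingVZ; ring.
have base_generic N : generic D (base N).
  move=> a k aR; have [c cR cE] := W0_roots wW aR.
  have [j jE] := integral_height Pibase d1 cR.
  suff -> : aff_root a k (base N) = aff_root a (k + N%:Z * j) p by exact: p_generic.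
  by rewrite base_lev cE jE /aff_root intrD intrM; ring.
have [N0 N0P] := B_up Pibase p wW dpos (xB _ _ (origin_vertex Pibase tahigh pA) wW).
have [N1 N1P] : exists N1, forall b N, b \in Pi -> (N1 <= N)%N ->
    up_pt D (base N) (x (alcove_vertex ta om b)) (y (alcove_vertex ta om b)).
  apply: eventually_seq => b bP.
  exact (B_up Pibase p wW dpos (xB _ _ (alcove_vertex_vertex Pibase tahigh omP pA bP) wW)).
pose N := maxn N0 N1.
have upN : up D (base N) p x y.
  pose vs := [set v | v = 0 \/ exists2 b, b \in Pi & v = alcove_vertex ta om b].
  apply: (@up_of_vertices R n D Pi ta Dred Pibase tahigh p pA (Wext D) vs) => //.
  - exact: Wext_preserves.
  - by move=> f a k aR; exact: Wext_refl.
  - move=> _ [->|[b bP ->]]; first exact: origin_closed.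
    exact (alcove_vertex_closed Pibase tahigh omP bP).
  - move=> f g fW gW fg; apply: (Wext_eq_vertices Pibase tahigh omP fW gW).
      by apply: fg; left.
    by move=> b bP; apply: fg; right; exists b.
  - move=> _ [->|[b bP ->]]; first by apply: N0P; exact: leq_maxl.
    by apply: N1P => //; exact: leq_maxr.
(* If [z p - p] is in the closed chamber of [w], no hyperplane between the
   base point and [p] lies between [p] and [z p]. *)
have acute z : (forall a, a \in roots D ->
      0 <= pairingV a (z p - p) * pairingV a (w d)) ->
    forall a k, a \in roots D -> sep a k (base N) p -> ~~ sep a k p (z p).
  move=> zP a k aR; have := zP a aR; rewrite /sep base_lev pairingVB -leNgt.
  have -> : pairingV a (z p) - pairingV a p = aff_root a k (z p) - aff_root a k p.
    by rewrite /aff_root; ring.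
  have N00 : 0 <= N%:R :> R by [].
  by move=> ut; exact: acute_sign N00 ut.
have pxy : up D p p x y.
  apply: (up_move_base Dred Pibase tahigh pA (base_generic N)) upN _ _.
  - exact: Wext_preserves.
  - exact: Wext_preserves.
  - apply: acute => a /wP; rewrite wpE mulrCA pmulr_rge0 //.
  apply: acute => a aR; have [c cR cE] := W0_roots wW aR.
  rewrite /y /translation addrC addKr !cE.
  exact (dominant_pairing Pibase mudom ddom cR).
have tpA : base_alcove Pi ta (tau p) by rewrite -tauA; exists p.
have gu := Waff_generated Dred Pibase tahigh pA uW.
rewrite xE in pxy; have [u' [gu' yE uu']] := up_bruhat Dred Pibase tahigh pA tpA gu pxy.
split=> //; exists w => //; exists u, u', tau; split=> //.
split=> //; exact: generated_Waff gu'.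
Qed.
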